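(* Fix $s,\mathtt R>1$ and complex numbers $z_1(0),z_{-1}(0)$. Let $J_1=\frac{|z_1(0)|^2+|z_{-1}(0)|^2}2$, $\mathfrak v(x)=2\,\mathrm{Re}(z_1(0)\overline{z_{-1}(0)}e^{\mathrm{i}2x})$ and $$\mathsf A=\mathrm{Op}^{BW}\big(\mathtt a(x)|\xi|^{2s}\eta_{\mathtt R}^2(\xi)\big),\qquad \mathtt a(x)=-\mathrm{Im}\big(z_1(0)\overline{z_{-1}(0)}e^{\mathrm{i}2x}\big).$$ Then: (i) (Positive commutator) One has $$\mathrm{i}\big[\mathsf A,\mathrm{Op}^{BW}((J_1+\mathfrak v(x))\xi)\big]\ge \mathtt I_1\,\mathrm{Op}^{BW}\big(|\xi|^{2s}\eta^2_{\mathtt R}(\xi)\big)+\mathsf R,$$ where $\mathtt I_1:=2|z_1(0)||z_{-1}(0)|\Big(2|z_1(0)||z_{-1}(0)|-\frac{|z_1(0)|^2+|z_{-1}(0)|^2}2\Big)$ and $\mathsf R:H^s\to H^{-s}$ satisfies $$\|\mathsf Ru\|_{-s}\le C_s\frac{|z_1(0)|^4+|z_{-1}(0)|^4}{\mathtt R}\|u\|_s .$$ (ii) (Upper bound) One has $$\mathsf A\le2|z_1(0)||z_{-1}(0)|\,\mathrm{Op}^{BW}\big(|\xi|^{2s}\eta_{\mathtt R}^2(\xi)\big)+\mathsf R,$$ with $\mathsf R:H^s\to H^{-s}$ (a possibly different operator) satisfying $$\|\mathsf Ru\|_{-s}\le C_s\frac{|z_1(0)|^2+|z_{-1}(0)|^2}{\mathtt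 R^2}\|u\|_s .$$
   Context: $\mathbb T=\mathbb R/2\pi\mathbb Z$, $\langle k\rangle=\max(1,|k|)$, $\|u\|_s^2=\sum_k\langle k\rangle^{2s}|u_k|^2$, $\langle u,v\rangle=\frac1{2\pi}\int_{\mathbb T}u\bar v\,dx$. $\eta_{\mathtt R}(\xi)=\eta(\xi/\mathtt R)$, where $\eta(y)=0$ for $y\le1$, $\eta(y)=1$ for $y\ge2$ and $\eta(y)=\frac{e^{-1/(y-1)}}{e^{-1/(y-1)}+e^{-1/(2-y)}}$ for $y\in(1,2)$. For operators, $\mathsf A\ge\mathsf B$ means $\langle\mathsf Au,u\rangle\ge\langle\mathsf Bu,u\rangle$ for all $u\in\bigcap_sH^s$. Bony-Weyl quantization: $\mathrm{Op}^{BW}(a)v=\sum_{j,k}\chi(k-j,\frac{j+k}2)\hat a(k-j,\frac{j+k}2)v_je^{\mathrm{i}kx}$, with $\hat a(n,\xi)$ the $n$-th Fourier coefficient of $a(\cdot,\xi)$ and $\chi(\xi',\xi)$ a fixed smooth real cut-off, even in each argument, supported in $|\xi'|\le\delta_0\langle\xi\rangle$ ($0<\delta_0\le\frac1{10}$), equal to $1$ for $|\xi'|\le\delta_0\langle\xi\rangle/2$, with $|\partial_\xi^\ell\partial_{\xi'}^\beta\chi|\lesssim\langle\xi\rangle^{-\ell-\beta}$. *)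

(* Defs.v *)
From Stdlib Require Import Reals ZArith Lra Lia Psatz FunctionalExtensionality.
From Coquelicot Require Import Coquelicot.
Open Scope R_scope.

(** * Sums over the integers and complex integrals *)

Definition neg_index (n : nat) : Z := (- Z.of_nat (S n))%Z.

Definition ex_Zseries (a : Z -> R) : Prop :=
  ex_series (fun n => a (Z.of_nat n)) /\ ex_series (fun n => a (neg_index n)).

Definition Zseries (a : Z -> R) : R :=
  Series (fun n => a (Z.of_nat n)) + Series (fun n => a (neg_index n)).

Definition CZseries (a : Z -> C) : C :=
  (Zseries (fun k => Re (a k)), Zseries (fun k => Im (a k))).

Definition CRInt (f : R -> C) (a b : R) : C :=
  (RInt (fun x => Re (f x)) a b, RInt (fun x => Im (f x)) a b).

(** [expi t] is e^{it}. *)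
Definition expi (t : R) : C := (cos t, sin t).

(** * Periodic distributions and Sobolev spaces

    A distribution u on R / 2 pi Z is given by its Fourier coefficients
    k |-> u_k, so that u = sum_k u_k e^{ikx}. *)

Definition pdist := Z -> C.

Definition jap (x : R) : R := Rmax 1 (Rabs x).

Definition sobolev_term (s : R) (u : pdist) (k : Z) : R :=
  Rpower (jap (IZR k)) (2 * s) * Cmod (u k) ^ 2.

Definition in_H (s : R) (u : pdist) : Prop := ex_Zseries (sobolev_term s u).

(** Meaningful when [in_H s u]: [Series] has an unspecified value on divergent
    series. *)
Definition norm_H (s : R) (u : pdist) : R := sqrt (Zseries (sobolev_term s u)).

Definition in_H_infty (u : pdist) : Prop := forall s : R, in_H s u.

(** The pairing <f, g> = (1 / 2 pi) int f conj(g) dx, in the form that also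
    makes sense as the duality between H^{-s} and H^s.  For functions with
    absolutely summable coefficients it is the integral: see
    [pairing_integral]. *)
Definition pairing (f g : pdist) : C := CZseries (fun k => f k * Cconj (g k))%C.

Definition synth (u : pdist) (x : R) : C :=
  CZseries (fun k => u k * expi (IZR k * x))%C.

(** * Operators *)

Definition operator := pdist -> pdist.

Definition op_add (A B : operator) : operator := fun u k => (A u k + B u k)%C.

Definition op_scal (c : C) (A : operator) : operator := fun u k => (c * A u k)%C.

Definition op_comm (A B : operator) : operator :=
  fun u k => (A (B u) k - B (A u) k)%C.

(** z >= w for complex numbers: z - w is real and nonnegative. *)
Definition Cge (z w : C) : Prop := Im z = Im w /\ Re w <= Re z.

Definition op_ge (A B : operator) : Prop :=
  forall u, in_H_infty u -> Cge (pairing (A u) u) (pairing (B u) u).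

(** [T : H^s -> H^t] linear with operator norm at most [M]; the values of [T]
    outside H^s are irrelevant. *)
Definition bounded_linear (s t M : R) (T : operator) : Prop :=
  (forall (c : C) (u v : pdist), in_H s u -> in_H s v ->
     forall k, T (fun j => c * u j + v j)%C k = (c * T u k + T v k)%C) /\
  (forall u, in_H s u -> in_H t (T u) /\ norm_H t (T u) <= M * norm_H s u).

(** * Bony-Weyl quantization *)

(** For [f] a function of (xi', xi): partial derivatives in xi' and in xi. *)
Definition partial1 (f : R -> R -> R) : R -> R -> R :=
  fun x' x => Derive (fun y => f y x) x'.

Definition partial2 (f : R -> R -> R) : R -> R -> R :=
  fun x' x => Derive (fun y => f x' y) x.

Fixpoint Ck2 (n : nat) (f : R -> R -> R) : Prop :=
  match n with
  | O => forall p : R * R, continuous (fun q : R * R => f (fst q) (snd q)) p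
  | S m => (forall x' x, ex_derive (fun y => f y x) x') /\
           (forall x' x, ex_derive (fun y => f x' y) x) /\
           Ck2 m (partial1 f) /\ Ck2 m (partial2 f)
  end.

Record BW_cutoff (delta0 : R) (chi : R -> R -> R) : Prop := {
  cutoff_delta : 0 < delta0 <= 1 / 10;
  cutoff_smooth : forall n, Ck2 n chi;
  cutoff_even1 : forall x' x, chi (- x') x = chi x' x;
  cutoff_even2 : forall x' x, chi x' (- x) = chi x' x;
  cutoff_supp : forall x' x, delta0 * jap x < Rabs x' -> chi x' x = 0;
  cutoff_one : forall x' x, Rabs x' <= delta0 * jap x / 2 -> chi x' x = 1;
  cutoff_bound : forall l b : nat, exists K : R, forall x' x,
    Rabs (Nat.iter l partial2 (Nat.iter b partial1 chi) x' x)
      <= K * Rpower (jap x) (- (INR l + INR b))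
}.

Definition fourier_coeff (f : R -> C) (n : Z) : C :=
  (RtoC (/ (2 * PI)) * CRInt (fun x => f x * expi (- (IZR n * x))) 0 (2 * PI))%C.

Definition symbol := R -> R -> C.

(** The sum over j is finite, because chi (k - j, (j + k) / 2) vanishes for all
    but finitely many j. *)
Definition OpBW (chi : R -> R -> R) (a : symbol) : operator :=
  fun v k => CZseries (fun j =>
    RtoC (chi (IZR (k - j)) (IZR (j + k) / 2)%R)
    * fourier_coeff (fun x => a x (IZR (j + k) / 2)%R) (k - j)
    * v j)%C.

(** * The symbols of the commutator estimate *)

Definition eta (y : R) : R :=
  if Rle_dec y 1 then 0
  else if Rle_dec 2 y then 1
  else exp (- 1 / (y - 1)) / (exp (- 1 / (y - 1)) + exp (- 1 / (2 - y))).

(** |xi|^p for p > 0; [Rpower] gives a nonzero value at xi = 0. *)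
Definition abspow (xi p : R) : R :=
  if Req_EM_T xi 0 then 0 else Rpower (Rabs xi) p.

Definition weight (s RR xi : R) : R := abspow xi (2 * s) * eta (xi / RR) ^ 2.

Definition J1 (z1 zm1 : C) : R := (Cmod z1 ^ 2 + Cmod zm1 ^ 2) / 2.

Definition vfrak (z1 zm1 : C) (x : R) : R :=
  2 * Re (z1 * Cconj zm1 * expi (2 * x))%C.

Definition afrak (z1 zm1 : C) (x : R) : R :=
  - Im (z1 * Cconj zm1 * expi (2 * x))%C.

Definition I1 (z1 zm1 : C) : R :=
  2 * Cmod z1 * Cmod zm1
  * (2 * Cmod z1 * Cmod zm1 - (Cmod z1 ^ 2 + Cmod zm1 ^ 2) / 2).

Definition opA (chi : R -> R -> R) (s RR : R) (z1 zm1 : C) : operator :=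
  OpBW chi (fun x xi => RtoC (afrak z1 zm1 x * weight s RR xi)).

Definition opTransport (chi : R -> R -> R) (z1 zm1 : C) : operator :=
  OpBW chi (fun x xi => RtoC ((J1 z1 zm1 + vfrak z1 zm1 x) * xi)).

Definition opWeight (chi : R -> R -> R) (s RR : R) : operator :=
  OpBW chi (fun x xi => RtoC (weight s RR xi)).

(** * The pairing is the L^2 product *)

Lemma is_RInt_Series (phi : nat -> R -> R) (M : nat -> R) (a b : R) :
  ex_series M -> (forall n x, Rabs (phi n x) <= M n) ->
  (forall n, ex_RInt (phi n) a b) ->
  is_RInt (fun x => Series (fun n => phi n x)) a b
          (Series (fun n => RInt (phi n) a b)).
Proof.
intros HM Hb Hint.
assert (Hex : forall x, ex_series (fun n => phi n x)).
{ intros x. apply ex_series_Rabs.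
  apply (@ex_series_le R_AbsRing R_CompleteNormedModule _ M); trivial.
  intros n. unfold norm; simpl; unfold abs; simpl; try rewrite Rabs_Rabsolu. apply Hb. }
assert (Hh : forall N, is_RInt (fun x => sum_n (fun n => phi n x) N) a b
                               (sum_n (fun n => RInt (phi n) a b) N)).
{ induction N as [|N IH].
  - apply is_RInt_ext with (phi 0%nat).
    + intros x _. now rewrite sum_O.
    + rewrite sum_O. now apply (@RInt_correct R_CompleteNormedModule).
  - rewrite sum_Sn.
    apply is_RInt_ext with
      (fun x => plus (sum_n (fun n => phi n x) N) (phi (S N) x)).
    + intros x _. now rewrite sum_Sn.
    + apply (is_RInt_plus (V := R_NormedModule)); trivial.
      now apply (@RInt_correct R_CompleteNormedModule). }
destruct (filterlim_RInt (V := R_CompleteNormedModule)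
   (fun N x => sum_n (fun n => phi n x) N) a b eventually _
   (fun x => Series (fun n => phi n x)) _ Hh) as [If [H1 H2]].
- apply filterlim_locally. intros eps.
  destruct HM as [LM HLM].
  assert (HL : is_lim_seq (sum_n M) LM) by exact HLM.
  apply is_lim_seq_spec in HL. destruct (HL eps) as [N HN].
  exists N. intros n Hn x. specialize (HN n Hn).
  unfold ball; simpl. unfold AbsRing_ball, abs, minus, plus, opp; simpl.
  rewrite (Series_incr_n (fun n => phi n x) (S n)); [|lia|apply Hex].
  rewrite <- sum_n_Reals. simpl Init.Nat.pred.
  assert (HS : Series M = LM) by now apply is_series_unique.
  rewrite <- HS in HN.
  rewrite (Series_incr_n M (S n)) in HN; [|lia|now exists LM].
  rewrite <- sum_n_Reals in HN. simpl Init.Nat.pred in HN.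
  assert (HMn : ex_series (fun k => M (S n + k)%nat))
    by (apply (ex_series_incr_n M (S n)); now exists LM).
  assert (HT : Rabs (Series (fun k => phi (S n + k)%nat x))
               <= Series (fun k => M (S n + k)%nat)).
  { eapply Rle_trans; [apply Series_Rabs|apply Series_le]; trivial.
    - apply (@ex_series_le R_AbsRing R_CompleteNormedModule _
               (fun k => M (S n + k)%nat)); trivial.
      intros k. unfold norm; simpl; unfold abs; simpl; try rewrite Rabs_Rabsolu. apply Hb.
    - intros k. split; [apply Rabs_pos|apply Hb]. }
  match type of HN with Rabs ?X < _ =>
    assert (HX : - X < eps) by (apply Rabs_def2 in HN; lra) end.
  match goal with |- Rabs ?Y < _ =>
    replace Y with (- Series (fun k => phi (S n + k)%nat x)) by ring end.
  rewrite Rabs_Ropp. lra.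
- replace (Series (fun n => RInt (phi n) a b)) with If; trivial.
  symmetry. apply is_series_unique. exact H1.
Qed.

Lemma is_RInt_Zseries (phi : Z -> R -> R) (M : Z -> R) (a b : R) :
  ex_Zseries M -> (forall k x, Rabs (phi k x) <= M k) ->
  (forall k, ex_RInt (phi k) a b) ->
  is_RInt (fun x => Zseries (fun k => phi k x)) a b
          (Zseries (fun k => RInt (phi k) a b)).
Proof.
intros [H1 H2] Hb Hint. unfold Zseries.
apply (is_RInt_plus (V := R_NormedModule)).
- now apply (is_RInt_Series (fun n => phi (Z.of_nat n)) (fun n => M (Z.of_nat n))).
- now apply (is_RInt_Series (fun n => phi (neg_index n)) (fun n => M (neg_index n))).
Qed.

Lemma ex_Zseries_le (a M : Z -> R) :
  ex_Zseries M -> (forall k, Rabs (a k) <= M k) -> ex_Zseries a.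
Proof.
intros [H1 H2] Hb. split.
- exact (@ex_series_le R_AbsRing R_CompleteNormedModule
           (fun n => a (Z.of_nat n)) _ (fun n => Hb _) H1).
- exact (@ex_series_le R_AbsRing R_CompleteNormedModule
           (fun n => a (neg_index n)) _ (fun n => Hb _) H2).
Qed.

Lemma Zseries_abs_le (a M : Z -> R) :
  ex_Zseries M -> (forall k, Rabs (a k) <= M k) -> Rabs (Zseries a) <= Zseries M.
Proof.
intros HM Hb.
assert (HA : ex_Zseries (fun k => Rabs (a k))).
{ apply ex_Zseries_le with M; trivial. intros k; rewrite Rabs_Rabsolu; apply Hb. }
destruct HM as [H1 H2], HA as [A1 A2]. unfold Zseries.
eapply Rle_trans; [apply Rabs_triang|]. apply Rplus_le_compat.
- eapply Rle_trans; [now apply Series_Rabs|].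
  apply Series_le; trivial. intros n; split; [apply Rabs_pos|apply Hb].
- eapply Rle_trans; [now apply Series_Rabs|].
  apply Series_le; trivial. intros n; split; [apply Rabs_pos|apply Hb].
Qed.

Lemma Zseries_ext (a b : Z -> R) : (forall k, a k = b k) -> Zseries a = Zseries b.
Proof. intros H. f_equal; apply functional_extensionality; trivial. Qed.

Lemma CZseries_ext (a b : Z -> C) : (forall k, a k = b k) -> CZseries a = CZseries b.
Proof. intros H. f_equal; apply functional_extensionality; trivial. Qed.

Lemma Zseries_lin (a b : Z -> R) (x y : R) : ex_Zseries a -> ex_Zseries b ->
  Zseries (fun k => a k * x + b k * y) = Zseries a * x + Zseries b * y.
Proof.
intros [A1 A2] [B1 B2]. unfold Zseries.
rewrite 2!Series_plus; try (now apply ex_series_scal_r).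
rewrite 4!Series_scal_r. ring.
Qed.

Lemma Im_le_Cmod (c : C) : Rabs (Im c) <= Cmod c.
Proof.
eapply Rle_trans; [|apply (Rmax_Cmod c)]. apply Rmax_r.
Qed.

Lemma Cmod_le_sum (c : C) : Cmod c <= Rabs (Re c) + Rabs (Im c).
Proof.
replace c with (RtoC (Re c) + Ci * RtoC (Im c))%C at 1.
- eapply Rle_trans; [apply Cmod_triangle|].
  rewrite Cmod_mult, 2!Cmod_R.
  replace (Cmod Ci) with 1; [lra|].
  unfold Cmod, Ci; simpl. replace (0 * (0 * 1) + 1 * (1 * 1)) with 1 by ring.
  now rewrite sqrt_1.
- destruct c as [x y]. unfold Cplus, Cmult, Ci, RtoC, Re, Im; simpl. f_equal; ring.
Qed.

Lemma CZseries_mult_r (a : Z -> C) (c : C) : ex_Zseries (fun k => Cmod (a k)) ->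
  CZseries (fun k => a k * c)%C = (CZseries a * c)%C.
Proof.
intros H.
assert (HR : ex_Zseries (fun k => Re (a k)))
  by (apply ex_Zseries_le with (1 := H); intros k; apply re_le_Cmod).
assert (HI : ex_Zseries (fun k => Im (a k)))
  by (apply ex_Zseries_le with (1 := H); intros k; apply Im_le_Cmod).
apply injective_projections.
- change (Zseries (fun k => Re (a k * c)%C) = Zseries (fun k => Re (a k)) * Re c
            - Zseries (fun k => Im (a k)) * Im c).
  replace (Zseries (fun k => Re (a k)) * Re c - Zseries (fun k => Im (a k)) * Im c)
    with (Zseries (fun k => Re (a k)) * Re c + Zseries (fun k => Im (a k)) * (- Im c))
    by ring.
  rewrite <- (Zseries_lin _ _ _ _ HR HI). apply Zseries_ext; intros k.
  unfold Cmult, Re, Im; simpl; ring.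
- change (Zseries (fun k => Im (a k * c)%C) = Zseries (fun k => Re (a k)) * Im c
            + Zseries (fun k => Im (a k)) * Re c).
  rewrite <- (Zseries_lin _ _ _ _ HR HI). apply Zseries_ext; intros k.
  unfold Cmult, Re, Im; simpl; ring.
Qed.

Lemma CZseries_RtoC_mult_r (a : Z -> C) (r : R) :
  CZseries (fun k => a k * RtoC r)%C = (CZseries a * RtoC r)%C.
Proof.
apply injective_projections.
- change (Zseries (fun k => Re (a k * RtoC r)%C)
    = Zseries (fun k => Re (a k)) * r - Zseries (fun k => Im (a k)) * 0).
  rewrite Rmult_0_r, Rminus_0_r. unfold Zseries. rewrite Rmult_plus_distr_r.
  f_equal; rewrite <- Series_scal_r; apply Series_ext; intros n;
    unfold Cmult, Re; simpl; ring.
- change (Zseries (fun k => Im (a k * RtoC r)%C)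
    = Zseries (fun k => Re (a k)) * 0 + Zseries (fun k => Im (a k)) * r).
  rewrite Rmult_0_r, Rplus_0_l. unfold Zseries. rewrite Rmult_plus_distr_r.
  f_equal; rewrite <- Series_scal_r; apply Series_ext; intros n;
    unfold Cmult, Im; simpl; ring.
Qed.

Lemma CZseries_conj (a : Z -> C) :
  Cconj (CZseries a) = CZseries (fun k => Cconj (a k)).
Proof.
unfold CZseries, Cconj; simpl. f_equal. unfold Zseries; simpl.
rewrite 2!Series_opp. unfold Im. ring.
Qed.

Lemma Zseries_single (a : Z -> R) (k : Z) :
  (forall j, j <> k -> a j = 0) -> Zseries a = a k.
Proof.
intros H.
assert (H0 : forall b : nat -> R, (forall n, b n = 0) -> Series b = 0).
{ intros b Hb. rewrite (Series_ext b (fun n => 0 * b n)).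
  - rewrite Series_scal_l. ring.
  - intros n. rewrite Hb. ring. }
assert (H1 : forall (b : nat -> R) m, (forall n, n <> m -> b n = 0) -> Series b = b m).
{ intros b m Hb. rewrite (Series_incr_n_aux b m); [|intros n Hn; apply Hb; lia].
  rewrite Series_incr_1.
  - rewrite H0, Nat.add_0_r; [ring|]. intros n; apply Hb; lia.
  - apply (ex_series_incr_1 (fun i => b (m + i)%nat)).
    exists 0. apply is_series_ext with (fun _ => 0).
    + intros n. symmetry; apply Hb; lia.
    + change (is_lim_seq (sum_n (fun _ => 0)) 0).
      apply is_lim_seq_ext with (fun _ => 0); [|apply is_lim_seq_const].
      intros n. induction n as [|n IH]; [now rewrite sum_O|].
      rewrite sum_Sn, <- IH. unfold plus; simpl; ring. }
unfold Zseries. destruct (Z_le_dec 0 k) as [Hk|Hk].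
- rewrite (H1 _ (Z.to_nat k)), (H0 (fun n => a (neg_index n))).
  + rewrite Z2Nat.id; [ring|lia].
  + intros n; apply H; unfold neg_index; lia.
  + intros n Hn; apply H; lia.
- rewrite (H0 (fun n => a (Z.of_nat n))), (H1 _ (Z.to_nat (- k - 1))).
  + replace (neg_index _) with k; [ring|unfold neg_index; lia].
  + intros n Hn; apply H; unfold neg_index; lia.
  + intros n; apply H; lia.
Qed.

Lemma CZseries_single (a : Z -> C) (k : Z) :
  (forall j, j <> k -> a j = 0%C) -> CZseries a = a k.
Proof.
intros H. unfold CZseries.
rewrite 2!(Zseries_single _ k); try (intros j Hj; now rewrite H).
now destruct (a k).
Qed.

Definition Cex_RInt (f : R -> C) (a b : R) : Prop :=
  ex_RInt (fun x => Re (f x)) a b /\ ex_RInt (fun x => Im (f x)) a b.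

Lemma CRInt_ext (f g : R -> C) (a b : R) :
  (forall x, f x = g x) -> CRInt f a b = CRInt g a b.
Proof. intros H. now replace g with f by (apply functional_extensionality; trivial). Qed.

Lemma CRInt_CZseries (phi : Z -> R -> C) (M : Z -> R) (a b : R) :
  ex_Zseries M -> (forall k x, Cmod (phi k x) <= M k) ->
  (forall k, Cex_RInt (phi k) a b) ->
  Cex_RInt (fun x => CZseries (fun k => phi k x)) a b /\
  CRInt (fun x => CZseries (fun k => phi k x)) a b
    = CZseries (fun k => CRInt (phi k) a b).
Proof.
intros HM Hb Hint.
assert (HR := is_RInt_Zseries (fun k x => Re (phi k x)) M a b HM
  (fun k x => Rle_trans _ _ _ (re_le_Cmod _) (Hb k x)) (fun k => proj1 (Hint k))).
assert (HI := is_RInt_Zseries (fun k x => Im (phi k x)) M a b HM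
  (fun k x => Rle_trans _ _ _ (Im_le_Cmod _) (Hb k x)) (fun k => proj2 (Hint k))).
split; [split; eexists; [exact HR|exact HI]|].
unfold CRInt at 1. unfold CZseries at 3. f_equal.
- exact (is_RInt_unique _ _ _ _ HR).
- exact (is_RInt_unique _ _ _ _ HI).
Qed.

Lemma expi_add (x y : R) : (expi x * expi y)%C = expi (x + y).
Proof.
unfold expi, Cmult; simpl. rewrite cos_plus, sin_plus. f_equal; ring.
Qed.

Lemma expi_conj (x : R) : Cconj (expi x) = expi (- x).
Proof. unfold expi, Cconj; simpl. now rewrite cos_neg, sin_neg. Qed.

Lemma Cmod_expi (x : R) : Cmod (expi x) = 1.
Proof.
unfold Cmod, expi; simpl.
replace (_ + _) with 1; [apply sqrt_1|].
generalize (sin2_cos2 x). unfold Rsqr. lra.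
Qed.

Lemma expi_2PI (n : Z) : expi (IZR n * (2 * PI)) = 1%C.
Proof.
assert (HN : forall m : nat, expi (INR m * (2 * PI)) = 1%C).
{ intros m. unfold expi.
  replace (INR m * (2 * PI)) with (0 + 2 * INR m * PI) by ring.
  now rewrite cos_period, sin_period, cos_0, sin_0. }
destruct (Z_le_dec 0 n) as [Hn|Hn].
- rewrite <- (Z2Nat.id n) by lia. rewrite <- INR_IZR_INZ. apply HN.
- replace n with (- Z.of_nat (Z.to_nat (- n)))%Z by lia.
  rewrite opp_IZR, <- INR_IZR_INZ, Ropp_mult_distr_l_reverse, <- expi_conj, HN.
  unfold Cconj, RtoC; simpl. f_equal; ring.
Qed.

Lemma RInt_trig (n : Z) (p q : R) :
  is_RInt (fun x => p * cos (IZR n * x) + q * sin (IZR n * x)) 0 (2 * PI)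
          (if Z.eq_dec n 0 then 2 * PI * p else 0).
Proof.
destruct (Z.eq_dec n 0) as [->|Hn].
- apply is_RInt_ext with (fun _ => p).
  + intros x _. rewrite Rmult_0_l, cos_0, sin_0. simpl; ring.
  + replace (2 * PI * p) with (scal (2 * PI - 0) p) by (unfold scal; simpl; unfold mult; simpl; ring).
    apply (is_RInt_const (V := R_NormedModule)).
- assert (Hn' : IZR n <> 0) by (intros H; apply Hn; now apply eq_IZR).
  set (F := fun x => (p * sin (IZR n * x) - q * cos (IZR n * x)) / IZR n).
  assert (HE := expi_2PI n). injection HE as Hc Hs.
  replace 0 with (minus (F (2 * PI)) (F 0)) at 2.
  + apply (is_RInt_derive (V := R_CompleteNormedModule)).
    * intros x _. unfold F. auto_derive; trivial. field; trivial.
    * intros x _. apply (ex_derive_continuous (V := R_NormedModule)). now auto_derive.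
  + change (F (2 * PI) + - F 0 = 0). unfold F.
    rewrite Hc, Hs, (Rmult_0_r (IZR n)), cos_0, sin_0. field; trivial.
Qed.

Lemma CRInt_expi (c : C) (n : Z) :
  Cex_RInt (fun x => c * expi (IZR n * x))%C 0 (2 * PI) /\
  CRInt (fun x => c * expi (IZR n * x))%C 0 (2 * PI)
    = if Z.eq_dec n 0 then (RtoC (2 * PI) * c)%C else 0%C.
Proof.
assert (HR : is_RInt (fun x => Re (c * expi (IZR n * x))%C) 0 (2 * PI)
               (if Z.eq_dec n 0 then 2 * PI * Re c else 0)).
{ apply is_RInt_ext with (2 := RInt_trig n (Re c) (- Im c)).
  intros x _. unfold Re, Im, Cmult, expi; simpl. ring. }
assert (HI : is_RInt (fun x => Im (c * expi (IZR n * x))%C) 0 (2 * PI)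
               (if Z.eq_dec n 0 then 2 * PI * Im c else 0)).
{ apply is_RInt_ext with (2 := RInt_trig n (Im c) (Re c)).
  intros x _. unfold Re, Im, Cmult, expi; simpl. ring. }
split; [split; eexists; [exact HR|exact HI]|].
unfold CRInt. rewrite (is_RInt_unique _ _ _ _ HR), (is_RInt_unique _ _ _ _ HI).
destruct (Z.eq_dec n 0); trivial.
unfold Cmult, RtoC, Re, Im; simpl. f_equal; ring.
Qed.

Lemma pairing_integral (f g : pdist) :
  ex_Zseries (fun k => Cmod (f k)) -> ex_Zseries (fun k => Cmod (g k)) ->
  pairing f g = (RtoC (/ (2 * PI))
    * CRInt (fun x => synth f x * Cconj (synth g x)) 0 (2 * PI))%C.
Proof.
intros Hf Hg.
assert (Habs : forall (u : pdist) k x, Cmod (u k * expi (IZR k * x))%C = Cmod (u k)).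
{ intros u k x. rewrite Cmod_mult, Cmod_expi. ring. }
assert (Hsum : forall (u : pdist) x, ex_Zseries (fun k => Cmod (u k)) ->
          ex_Zseries (fun k => Cmod (u k * expi (IZR k * x))%C)).
{ intros u x Hu. apply ex_Zseries_le with (1 := Hu). intros k.
  rewrite Habs, Rabs_pos_eq; [lra|apply Cmod_ge_0]. }
assert (Hbd : forall x, Cmod (synth g x) <= 2 * Zseries (fun k => Cmod (g k))).
{ intros x. eapply Rle_trans; [apply Cmod_le_sum|].
  assert (Rabs (Re (synth g x)) <= Zseries (fun k => Cmod (g k))).
  { apply (Zseries_abs_le (fun k => Re (g k * expi (IZR k * x))%C)); trivial.
    intros k. rewrite <- (Habs g k x). apply re_le_Cmod. }
  assert (Rabs (Im (synth g x)) <= Zseries (fun k => Cmod (g k))).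
  { apply (Zseries_abs_le (fun k => Im (g k * expi (IZR k * x))%C)); trivial.
    intros k. rewrite <- (Habs g k x). apply Im_le_Cmod. }
  lra. }
assert (Hin : forall k,
  Cex_RInt (fun x => f k * expi (IZR k * x) * Cconj (synth g x))%C 0 (2 * PI) /\
  CRInt (fun x => f k * expi (IZR k * x) * Cconj (synth g x))%C 0 (2 * PI)
    = (RtoC (2 * PI) * (f k * Cconj (g k)))%C).
{ intros k.
  assert (E : forall x, (f k * expi (IZR k * x) * Cconj (synth g x))%C
    = CZseries (fun j => f k * Cconj (g j) * expi (IZR (k - j) * x))%C).
  { intros x. unfold synth. rewrite CZseries_conj, Cmult_comm, <- CZseries_mult_r.
    - apply CZseries_ext; intros j.
      rewrite Cmult_conj, expi_conj, minus_IZR.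
      replace ((IZR k - IZR j) * x) with (IZR k * x + - (IZR j * x)) by ring.
      rewrite <- expi_add. ring.
    - apply ex_Zseries_le with (1 := Hg). intros j.
      rewrite Cmod_conj, Habs, Rabs_pos_eq; [lra|apply Cmod_ge_0]. }
  rewrite (functional_extensionality _ _ E).
  destruct (CRInt_CZseries
     (fun j x => f k * Cconj (g j) * expi (IZR (k - j) * x))%C
     (fun j => Cmod (g j) * Cmod (f k) + Cmod (g j) * 0) 0 (2 * PI)) as [H1 H2].
  - destruct Hg as [G1 G2]. split.
    + apply (ex_series_plus (V := R_NormedModule)); now apply ex_series_scal_r.
    + apply (ex_series_plus (V := R_NormedModule)); now apply ex_series_scal_r.
  - intros j x. rewrite 2!Cmod_mult, Cmod_conj, Cmod_expi. lra.
  - intros j. apply CRInt_expi.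
  - split; trivial. rewrite H2, (CZseries_single _ k).
    + rewrite (proj2 (CRInt_expi _ _)).
      destruct (Z.eq_dec (k - k) 0); [trivial|lia].
    + intros j Hj. rewrite (proj2 (CRInt_expi _ _)).
      destruct (Z.eq_dec (k - j) 0); [lia|trivial]. }
set (Mg := 2 * Zseries (fun k => Cmod (g k))) in *.
assert (E : forall x, (synth f x * Cconj (synth g x))%C
  = CZseries (fun k => f k * expi (IZR k * x) * Cconj (synth g x))%C).
{ intros x. unfold synth at 1. rewrite <- CZseries_mult_r; [trivial|].
  now apply Hsum. }
rewrite (CRInt_ext _ _ _ _ E).
destruct (CRInt_CZseries
   (fun k x => f k * expi (IZR k * x) * Cconj (synth g x))%C
   (fun k => Cmod (f k) * Mg) 0 (2 * PI)) as [_ H2].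
- destruct Hf as [F1 F2]. split; now apply ex_series_scal_r.
- intros k x. rewrite Cmod_mult, Habs, Cmod_conj.
  apply Rmult_le_compat_l; [apply Cmod_ge_0|apply Hbd].
- intros k. apply Hin.
- rewrite H2, (CZseries_ext _ (fun k => (f k * Cconj (g k)) * RtoC (2 * PI))%C).
  + rewrite CZseries_RtoC_mult_r. unfold pairing.
    rewrite (Cmult_comm _ (RtoC (2 * PI))), Cmult_assoc, <- RtoC_mult.
    rewrite Rinv_l; [ring|]. generalize PI_RGT_0; lra.
  + intros k. rewrite (proj2 (Hin k)). ring.
Qed.

(* Main.v *)
Require Import Defs.
From Stdlib Require Import Reals ZArith Lra Lia Psatz FunctionalExtensionality.
From Coquelicot Require Import Coquelicot.
Open Scope R_scope.

(** Let zeta = z1 conj(zm1), w = [weight s RR] and c = [chi 2].  On Fourier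
    coefficients every operator of the theorem is a banded Hermitian matrix: the
    transport operator and A only couple k with k and k +- 2, and the commutator
    is pentadiagonal, with entries |zeta|^2 [c^2 w m]_{m=k-1}^{m=k+1} on the
    diagonal, J1 c w zeta at distance 2 and -(1/2) zeta^2 c c gam at distance 4,
    where gam(m) = w(m+1)(m-1) - (m+1)w(m-1) is nonnegative because w(m)/m is
    nondecreasing.  By Gershgorin, positivity modulo a diagonal remainder
    C <k>^{2s} reduces to a scalar inequality in each row.  There the first-order
    Taylor terms of w cancel, leaving 4 |zeta|^2 w - 2 |zeta| J1 w = I1 w, and the
    second-order ones are O(<k>^{2s-2}) on frequencies >~ RR, uniformly in RR;
    the factors c - 1 vanish at high frequency and contribute errors of the same
    size. *)

(** * Series over the integers and Hermitian band operators *)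

(** Why the sign of [gam] matters: to first order the diagonal entry is [2 w + 2 x w'] and [gam] is
    [2 x w' - 2 w], up to powers of |zeta|. Near the edge of the support [x w'] is not controlled by
    [w], and it has size <k>^{2s} with no gain in RR, so it fits neither in the main term nor in the
    remainder. It must cancel exactly, and this happens because the row sums contain [gam] itself
    instead of its absolute value. The two rates in RR have one source: each error is a Taylor
    remainder of [w] or a factor [c - 1] times [w], worth <k>^{2s} / RR^2. In the commutator the
    transport symbol multiplies it by the frequency, which costs one power of RR. Since [eta]
    vanishes on the whole half-line up to 1, [w] lives on positive frequencies above RR, away from
    the singularity of |xi|^{2s} at 0. *)

Lemma ex_Zseries_ext (a b : Z -> R) :
  (forall k, a k = b k) -> ex_Zseries a -> ex_Zseries b.
Proof. intros H Ha. now replace b with a by (apply functional_extensionality; trivial). Qed.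

Lemma ex_Zseries_plus (a b : Z -> R) :
  ex_Zseries a -> ex_Zseries b -> ex_Zseries (fun k => a k + b k).
Proof.
intros [A1 A2] [B1 B2]; split.
- exact (ex_series_plus (V := R_NormedModule) _ _ A1 B1).
- exact (ex_series_plus (V := R_NormedModule) _ _ A2 B2).
Qed.

Lemma ex_Zseries_scal (c : R) (a : Z -> R) :
  ex_Zseries a -> ex_Zseries (fun k => c * a k).
Proof.
intros [A1 A2]; split.
- exact (ex_series_scal_l (K := R_AbsRing) c _ A1).
- exact (ex_series_scal_l (K := R_AbsRing) c _ A2).
Qed.

Lemma Zseries_plus (a b : Z -> R) :
  ex_Zseries a -> ex_Zseries b -> Zseries (fun k => a k + b k) = Zseries a + Zseries b.
Proof.
intros Ha Hb. rewrite <- (Rmult_1_r (Zseries a)), <- (Rmult_1_r (Zseries b)).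
rewrite <- (Zseries_lin _ _ _ _ Ha Hb). apply Zseries_ext; intros k; ring.
Qed.

Lemma Zseries_scal (c : R) (a : Z -> R) : Zseries (fun k => c * a k) = c * Zseries a.
Proof. unfold Zseries. rewrite 2!Series_scal_l. ring. Qed.

Lemma Zseries_nonneg (a : Z -> R) : ex_Zseries a -> (forall k, 0 <= a k) -> 0 <= Zseries a.
Proof.
intros Ha H. eapply Rle_trans; [apply Rabs_pos|].
apply (Zseries_abs_le a a Ha). intros k; rewrite Rabs_pos_eq; [lra|apply H].
Qed.

Lemma Zseries_le (a b : Z -> R) :
  ex_Zseries a -> ex_Zseries b -> (forall k, a k <= b k) -> Zseries a <= Zseries b.
Proof.
intros Ha Hb H.
assert (P : 0 <= Zseries (fun k => b k + (-1) * a k)).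
{ apply Zseries_nonneg; [|intros k; specialize (H k); lra].
  apply ex_Zseries_plus; trivial. now apply ex_Zseries_scal. }
rewrite Zseries_plus, Zseries_scal in P; trivial; [lra|]. now apply ex_Zseries_scal.
Qed.

Lemma Zseries_succ (a : Z -> R) : ex_Zseries a ->
  ex_Zseries (fun k => a (k + 1)%Z) /\ Zseries (fun k => a (k + 1)%Z) = Zseries a.
Proof.
intros [H1 H2].
assert (P : forall n, a (Z.of_nat (S n)) = a (Z.of_nat n + 1)%Z)
  by (intros n; f_equal; lia).
assert (Q : forall n, a (neg_index n) = a (neg_index (S n) + 1)%Z)
  by (intros n; f_equal; unfold neg_index; lia).
assert (E1 : ex_series (fun n => a (Z.of_nat n + 1)%Z)).
{ apply ex_series_ext with (1 := P).
  now apply (ex_series_incr_1 (fun n => a (Z.of_nat n))). }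
assert (E2 : ex_series (fun n => a (neg_index n + 1)%Z)).
{ apply ex_series_incr_1. now apply ex_series_ext with (1 := Q). }
split; [now split|]. unfold Zseries.
rewrite (Series_incr_1 _ E2), (Series_incr_1 (fun n => a (Z.of_nat n)) H1).
rewrite <- (Series_ext _ _ P), <- (Series_ext _ _ Q).
(* The term at index 0 moves from the nonnegative half of the series to the negative half. *)
change (neg_index 0 + 1)%Z with (Z.of_nat 0). ring.
Qed.

Lemma Zseries_pred (a : Z -> R) : ex_Zseries a ->
  ex_Zseries (fun k => a (k - 1)%Z) /\ Zseries (fun k => a (k - 1)%Z) = Zseries a.
Proof.
intros [H1 H2].
assert (P : forall n, a (Z.of_nat n) = a (Z.of_nat (S n) - 1)%Z)
  by (intros n; f_equal; lia).
assert (Q : forall n, a (neg_index (S n)) = a (neg_index n - 1)%Z)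
  by (intros n; f_equal; unfold neg_index; lia).
assert (E1 : ex_series (fun n => a (Z.of_nat n - 1)%Z)).
{ apply ex_series_incr_1. now apply ex_series_ext with (1 := P). }
assert (E2 : ex_series (fun n => a (neg_index n - 1)%Z)).
{ apply ex_series_ext with (1 := Q).
  now apply (ex_series_incr_1 (fun n => a (neg_index n))). }
split; [now split|]. unfold Zseries.
rewrite (Series_incr_1 _ E1), (Series_incr_1 (fun n => a (neg_index n)) H2).
rewrite <- (Series_ext _ _ P), <- (Series_ext _ _ Q).
change (Z.of_nat 0 - 1)%Z with (neg_index 0). ring.
Qed.

Lemma Zseries_shift (a : Z -> R) (n : Z) : ex_Zseries a ->
  ex_Zseries (fun k => a (k + n)%Z) /\ Zseries (fun k => a (k + n)%Z) = Zseries a.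
Proof.
intros Ha. revert n. apply Z.peano_ind.
- split.
  + apply ex_Zseries_ext with (2 := Ha). intros k; f_equal; lia.
  + apply Zseries_ext. intros k; f_equal; lia.
- intros n [E S]. destruct (Zseries_succ _ E) as [E' S'].
  replace (fun k => a (k + Z.succ n)%Z) with (fun k => a (k + 1 + n)%Z)
    by (apply functional_extensionality; intros k; f_equal; lia).
  split; trivial. now rewrite <- S.
- intros n [E S]. destruct (Zseries_pred _ E) as [E' S'].
  replace (fun k => a (k + Z.pred n)%Z) with (fun k => a (k - 1 + n)%Z)
    by (apply functional_extensionality; intros k; f_equal; lia).
  split; trivial. now rewrite <- S.
Qed.

Lemma CZseries_plus (a b : Z -> C) :
  ex_Zseries (fun k => Cmod (a k)) -> ex_Zseries (fun k => Cmod (b k)) ->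
  CZseries (fun k => a k + b k)%C = (CZseries a + CZseries b)%C.
Proof.
intros Ha Hb. unfold CZseries, Cplus; simpl. f_equal.
- apply (Zseries_plus (fun k => Re (a k)) (fun k => Re (b k))).
  + apply ex_Zseries_le with (1 := Ha); intros k; apply re_le_Cmod.
  + apply ex_Zseries_le with (1 := Hb); intros k; apply re_le_Cmod.
- apply (Zseries_plus (fun k => Im (a k)) (fun k => Im (b k))).
  + apply ex_Zseries_le with (1 := Ha); intros k; apply Im_le_Cmod.
  + apply ex_Zseries_le with (1 := Hb); intros k; apply Im_le_Cmod.
Qed.

Lemma pairing_plus (f g h : pdist) :
  ex_Zseries (fun k => Cmod (f k * Cconj (h k))) ->
  ex_Zseries (fun k => Cmod (g k * Cconj (h k))) ->
  pairing (fun k => f k + g k)%C h = (pairing f h + pairing g h)%C.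
Proof.
intros Hf Hg. unfold pairing. rewrite <- CZseries_plus; trivial.
apply CZseries_ext; intros k; ring.
Qed.

(** * Quadratic forms of diagonal and band operators *)

Definition diag (d : Z -> R) : operator := fun u k => (RtoC (d k) * u k)%C.

(** The two-sided shift by [2 n] whose coefficients are indexed by the midpoint
    of the two frequencies it couples, as in the Weyl quantization. *)
Definition hop (n : Z) (b : Z -> C) : operator :=
  fun u k => (b (k - n)%Z * u (k - 2 * n)%Z + Cconj (b (k + n)%Z) * u (k + 2 * n)%Z)%C.

Definition quad (d : Z -> R) (u : pdist) : R := Zseries (fun k => d k * Cmod (u k) ^ 2).

Lemma diag_form (d : Z -> R) (u : pdist) :
  ex_Zseries (fun k => Rabs (d k) * Cmod (u k) ^ 2) ->
  ex_Zseries (fun k => Cmod (diag d u k * Cconj (u k))) /\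
  pairing (diag d u) u = RtoC (quad d u).
Proof.
intros H.
assert (E : forall k, (diag d u k * Cconj (u k))%C = RtoC (d k * Cmod (u k) ^ 2)).
{ intros k. unfold diag. rewrite <- Cmult_assoc, <- Cmod2_conj.
  now rewrite <- RtoC_mult. }
split.
- apply ex_Zseries_ext with (2 := H). intros k.
  rewrite E, Cmod_R, Rabs_mult, (Rabs_pos_eq (_ ^ 2)); [ring|apply pow2_ge_0].
- unfold pairing. rewrite (CZseries_ext _ _ E). unfold CZseries, RtoC at 3. f_equal.
  apply (Zseries_single (fun _ => 0) 0%Z). trivial.
Qed.

(** This is the Gershgorin bound. The two shifts are adjoint to each other, so the form is twice the
    real part of one sum; [2 x y <= x^2 + y^2] shares each term between the two frequencies it
    couples, and reindexing collects at frequency [m] the moduli of its two entries. *)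
Lemma hop_form (n : Z) (b : Z -> C) (u : pdist) :
  ex_Zseries (fun m => Cmod (b (m - n)%Z) * Cmod (u m) ^ 2) ->
  ex_Zseries (fun m => Cmod (b (m + n)%Z) * Cmod (u m) ^ 2) ->
  ex_Zseries (fun k => Cmod (hop n b u k * Cconj (u k))) /\
  exists S, pairing (hop n b u) u = RtoC S /\
    Rabs S <= quad (fun m => Cmod (b (m - n)%Z) + Cmod (b (m + n)%Z)) u.
Proof.
intros Hm Hp.
set (q := fun m => (b m * u (m - n)%Z * Cconj (u (m + n)%Z))%C).
destruct (Zseries_shift _ n Hm) as [Em Sm].
destruct (Zseries_shift _ (- n) Hp) as [Ep Sp].
set (M := fun m => Cmod (b m) * Cmod (u (m + n)%Z) ^ 2 + Cmod (b m) * Cmod (u (m - n)%Z) ^ 2).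
assert (EM : ex_Zseries M /\ Zseries M = quad (fun m => Cmod (b (m - n)%Z) + Cmod (b (m + n)%Z)) u).
{ assert (Em' : ex_Zseries (fun m => Cmod (b m) * Cmod (u (m + n)%Z) ^ 2)).
  { apply ex_Zseries_ext with (2 := Em). intros k. now rewrite Z.add_simpl_r. }
  assert (Ep' : ex_Zseries (fun m => Cmod (b m) * Cmod (u (m - n)%Z) ^ 2)).
  { apply ex_Zseries_ext with (2 := Ep). intros k.
    now replace (k + - n + n)%Z with k by ring. }
  split; [now apply ex_Zseries_plus|].
  unfold M, quad. rewrite Zseries_plus; trivial.
  rewrite (Zseries_ext (fun k => (_ + _) * _)
    (fun m => Cmod (b (m - n)%Z) * Cmod (u m) ^ 2 + Cmod (b (m + n)%Z) * Cmod (u m) ^ 2))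
    by (intros k; ring).
  rewrite Zseries_plus, <- Sm, <- Sp; trivial.
  f_equal; apply Zseries_ext; intros k.
  - now rewrite Z.add_simpl_r.
  - now replace (k + - n + n)%Z with k by ring. }
destruct EM as [EM SM].
assert (Hq : forall m, 2 * Cmod (q m) <= M m).
{ intros m. unfold q, M. rewrite 2!Cmod_mult, Cmod_conj.
  set (x := Cmod (u (m - n)%Z)). set (y := Cmod (u (m + n)%Z)).
  assert (0 <= Cmod (b m)) by apply Cmod_ge_0.
  assert (0 <= (x - y) ^ 2) by apply pow2_ge_0. nra. }
assert (Eq : ex_Zseries (fun m => Cmod (q m))).
{ apply ex_Zseries_le with (1 := EM). intros m.
  rewrite Rabs_pos_eq by apply Cmod_ge_0.
  specialize (Hq m). assert (0 <= Cmod (q m)) by apply Cmod_ge_0. lra. }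
(* The midpoint [m] is seen from row [m + n] as [q m] and from row [m - n] as its conjugate. *)
assert (T : forall k, (hop n b u k * Cconj (u k))%C = (q (k + - n)%Z + Cconj (q (k + n)%Z))%C).
{ intros k. unfold hop, q. rewrite !Cmult_conj, Cconj_conj.
  replace (k + - n - n)%Z with (k - 2 * n)%Z by ring.
  replace (k + - n + n)%Z with k by ring.
  replace (k + n + n)%Z with (k + 2 * n)%Z by ring.
  replace (k + n - n)%Z with k by ring.
  replace (k + - n)%Z with (k - n)%Z by ring. ring. }
assert (Er : ex_Zseries (fun m => Re (q m)))
  by (apply ex_Zseries_le with (1 := Eq); intros m; apply re_le_Cmod).
assert (Ei : ex_Zseries (fun m => Im (q m)))
  by (apply ex_Zseries_le with (1 := Eq); intros m; apply Im_le_Cmod).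
split.
- apply ex_Zseries_le with (fun k => Cmod (q (k + - n)%Z) + Cmod (q (k + n)%Z)).
  + apply ex_Zseries_plus.
    * apply (Zseries_shift _ (- n) Eq).
    * apply (Zseries_shift _ n Eq).
  + intros k. rewrite Rabs_pos_eq by apply Cmod_ge_0. rewrite T.
    eapply Rle_trans; [apply Cmod_triangle|]. rewrite Cmod_conj. lra.
- exists (2 * Zseries (fun m => Re (q m))). split.
  + unfold pairing. rewrite (CZseries_ext _ _ T). unfold CZseries, RtoC. f_equal.
    * destruct (Zseries_shift _ (- n) Er) as [E1 S1].
      destruct (Zseries_shift _ n Er) as [E2 S2].
      rewrite (Zseries_ext _ (fun k => Re (q (k + - n)%Z) + Re (q (k + n)%Z)))
        by (intros k; unfold Re, Cplus, Cconj; simpl; ring).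
      rewrite Zseries_plus, S1, S2; trivial. ring.
    * destruct (Zseries_shift _ (- n) Ei) as [E1 S1].
      destruct (Zseries_shift _ n Ei) as [E2 S2].
      rewrite (Zseries_ext _ (fun k => Im (q (k + - n)%Z) + (-1) * Im (q (k + n)%Z)))
        by (intros k; unfold Im, Cplus, Cconj; simpl; ring).
      rewrite Zseries_plus, Zseries_scal, S1, S2; trivial; [ring|].
      now apply ex_Zseries_scal.
  + rewrite <- SM, <- Zseries_scal.
    apply Zseries_abs_le; trivial. intros m.
    rewrite Rabs_mult, (Rabs_pos_eq 2) by lra.
    eapply Rle_trans; [|apply Hq]. apply Rmult_le_compat_l; [lra|apply re_le_Cmod].
Qed.

(** * Bony-Weyl operators with symbols of degree two in e^{ix} *)

Lemma CRInt_plus (f g : R -> C) (a b : R) :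
  Cex_RInt f a b -> Cex_RInt g a b ->
  Cex_RInt (fun x => f x + g x)%C a b /\
  CRInt (fun x => f x + g x)%C a b = (CRInt f a b + CRInt g a b)%C.
Proof.
intros [F1 F2] [G1 G2]. split; [split|].
- exact (ex_RInt_plus (V := R_NormedModule) _ _ a b F1 G1).
- exact (ex_RInt_plus (V := R_NormedModule) _ _ a b F2 G2).
- unfold CRInt, Cplus at 3; simpl. f_equal.
  + exact (RInt_plus (V := R_CompleteNormedModule) _ _ a b F1 G1).
  + exact (RInt_plus (V := R_CompleteNormedModule) _ _ a b F2 G2).
Qed.

Definition trig2 (p0 p1 p2 : C) (x : R) : C :=
  (p0 + p1 * expi (2 * x) + p2 * expi (- (2 * x)))%C.

Lemma fourier_coeff_trig2 (p0 p1 p2 : C) (n : Z) :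
  fourier_coeff (trig2 p0 p1 p2) n =
  if Z.eq_dec n 0 then p0 else if Z.eq_dec n 2 then p1
  else if Z.eq_dec n (-2) then p2 else 0%C.
Proof.
unfold fourier_coeff.
rewrite (CRInt_ext _ (fun x => p0 * expi (IZR (- n) * x)
  + p1 * expi (IZR (2 - n) * x) + p2 * expi (IZR (-2 - n) * x))%C).
2:{ intros x. unfold trig2. rewrite opp_IZR, !minus_IZR.
  replace ((2 - IZR n) * x) with (2 * x + - (IZR n * x)) by ring.
  replace ((-2 - IZR n) * x) with (- (2 * x) + - (IZR n * x)) by ring.
  replace (- IZR n * x) with (- (IZR n * x)) by ring.
  rewrite <- !expi_add. ring. }
destruct (CRInt_expi p0 (- n)) as [E0 I0].
destruct (CRInt_expi p1 (2 - n)) as [E1 I1].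
destruct (CRInt_expi p2 (-2 - n)) as [E2 I2].
destruct (CRInt_plus _ _ _ _ E0 E1) as [E01 I01].
rewrite (proj2 (CRInt_plus _ _ _ _ E01 E2)), I01, I0, I1, I2.
assert (HP : (RtoC (/ (2 * PI)) * RtoC (2 * PI))%C = 1%C).
{ rewrite <- RtoC_mult, Rinv_l; trivial. generalize PI_RGT_0; lra. }
destruct (Z.eq_dec n 0), (Z.eq_dec n 2), (Z.eq_dec n (-2)),
  (Z.eq_dec (- n) 0), (Z.eq_dec (2 - n) 0), (Z.eq_dec (-2 - n) 0);
  try lia; rewrite ?Cplus_0_l, ?Cplus_0_r, ?Cmult_0_r, ?Cmult_assoc, ?HP; ring.
Qed.

Lemma ex_series_zero (a : nat -> R) : (forall n, a n = 0) -> ex_series a.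
Proof.
intros H. exists 0. change (is_lim_seq (sum_n a) 0).
apply is_lim_seq_ext with (fun _ => 0); [|apply is_lim_seq_const].
intros n. induction n as [|n IH]; [now rewrite sum_O|].
rewrite sum_Sn, <- IH, H. unfold plus; simpl; ring.
Qed.

(** [CZseries] is additive only on convergent families, so the sequence is split into three
    sequences supported at one point each; their convergence is checked by shifting that point to
    0. *)
Lemma CZseries_three (a : Z -> C) (i j k : Z) : i <> j -> i <> k -> j <> k ->
  (forall m, m <> i -> m <> j -> m <> k -> a m = 0%C) ->
  CZseries a = (a i + a j + a k)%C.
Proof.
intros Hij Hik Hjk H.
set (at_ := fun p m => if Z.eq_dec m p then a p else 0%C).
assert (S : forall p, CZseries (at_ p) = a p).
{ intros p. rewrite (CZseries_single _ p).
  - unfold at_. now destruct (Z.eq_dec p p).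
  - intros m Hm. unfold at_. now destruct (Z.eq_dec m p). }
assert (X : forall p, ex_Zseries (fun m => Cmod (at_ p m))).
{ intros p.
  assert (E0 : ex_Zseries (fun m => if Z.eq_dec m 0 then Cmod (a p) else 0)).
  { split.
    - apply ex_series_incr_1, ex_series_zero. intros n.
      now destruct (Z.eq_dec (Z.of_nat (Datatypes.S n)) 0).
    - apply ex_series_zero. intros n. now destruct (Z.eq_dec (neg_index n) 0). }
  apply ex_Zseries_ext with (2 := proj1 (Zseries_shift _ (- p) E0)).
  intros m. unfold at_.
  destruct (Z.eq_dec (m + - p) 0), (Z.eq_dec m p); try lia; trivial.
  now rewrite Cmod_0. }
rewrite (CZseries_ext a (fun m => (at_ i m + at_ j m) + at_ k m)%C).
- rewrite 2!CZseries_plus, !S; trivial.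
  apply ex_Zseries_le with (1 := ex_Zseries_plus _ _ (X i) (X j)). intros m.
  rewrite Rabs_pos_eq by apply Cmod_ge_0. apply Cmod_triangle.
- intros m. unfold at_.
  destruct (Z.eq_dec m i), (Z.eq_dec m j), (Z.eq_dec m k); subst; try contradiction;
    try (rewrite H by trivial); ring.
Qed.

(** Only the frequency differences 0, 2 and -2 survive, and the midpoint of [k] and [k -+ 2] is
    [k -+ 1]. Evenness of [chi] in its first argument gives both neighbours the factor [chi 2]; on
    the diagonal [chi 0] is 1. *)
Lemma OpBW_trig2 (delta0 : R) (chi : R -> R -> R) (Hchi : BW_cutoff delta0 chi)
    (a : symbol) (p0 p1 p2 : R -> C) :
  (forall x xi, a x xi = trig2 (p0 xi) (p1 xi) (p2 xi) x) ->
  forall v k, OpBW chi a v k =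
    (p0 (IZR k) * v k
     + RtoC (chi 2 (IZR (k - 1))) * p1 (IZR (k - 1)) * v (k - 2)%Z
     + RtoC (chi 2 (IZR (k + 1))) * p2 (IZR (k + 1)) * v (k + 2)%Z)%C.
Proof.
intros Ha v k. unfold OpBW.
assert (F : forall xi n, fourier_coeff (fun x => a x xi) n =
  if Z.eq_dec n 0 then p0 xi else if Z.eq_dec n 2 then p1 xi
  else if Z.eq_dec n (-2) then p2 xi else 0%C).
{ intros xi n. rewrite <- fourier_coeff_trig2. f_equal.
  apply functional_extensionality; intros x; apply Ha. }
rewrite (CZseries_three _ k (k - 2) (k + 2)); try lia.
- rewrite !F.
  replace (k - k)%Z with 0%Z by ring.
  replace (k - (k - 2))%Z with 2%Z by ring.
  replace (k - (k + 2))%Z with (-2)%Z by ring. simpl.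
  replace (IZR (k + k) / 2) with (IZR k) by (rewrite plus_IZR; field).
  replace (IZR (k - 2 + k) / 2) with (IZR (k - 1))
    by (rewrite plus_IZR, !minus_IZR; field).
  replace (IZR (k + 2 + k) / 2) with (IZR (k + 1)) by (rewrite !plus_IZR; field).
  rewrite (cutoff_even1 _ _ Hchi 2), (cutoff_one _ _ Hchi 0).
  + ring.
  + rewrite Rabs_R0. destruct (cutoff_delta _ _ Hchi) as [H _].
    assert (1 <= jap (IZR k)) by apply Rmax_l. nra.
- intros m H0 H1 H2. rewrite F.
  destruct (Z.eq_dec (k - m) 0), (Z.eq_dec (k - m) 2), (Z.eq_dec (k - m) (-2)); try lia.
  ring.
Qed.

(** * Regularity of eta and of the weight *)

(** A family closed under differentiation that starts at e^{-1/t}: the derivatives of [eta] are then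
    rational expressions in its members, with no case analysis at the gluing points 1 and 2. *)
Definition flat (n : nat) (t : R) : R :=
  if Rle_dec t 0 then 0 else (/ t) ^ n * exp (- / t).

Lemma pow_le_fact_exp (n : nat) (x : R) : 0 <= x -> x ^ n <= INR (fact n) * exp x.
Proof.
intros Hx.
assert (F : 0 < INR (fact n)) by apply INR_fact_lt_0.
assert (H : x ^ n / INR (fact n) <= exp x).
{ eapply Rle_trans; [|apply (exp_ge_taylor x n Hx)].
  destruct n as [|n]; [apply Rle_refl|].
  assert (0 <= sum_f_R0 (fun k => x ^ k / INR (fact k)) n).
  { apply cond_pos_sum. intros k.
    apply Rmult_le_pos; [now apply pow_le|].
    apply Rlt_le, Rinv_0_lt_compat, INR_fact_lt_0. }
  change (x ^ S n / INR (fact (S n)) <= sum_f_R0 (fun k => x ^ k / INR (fact k)) n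
    + x ^ S n / INR (fact (S n))).
  lra. }
apply (Rmult_le_compat_l (INR (fact n))) in H; [|lra].
replace (INR (fact n) * (x ^ n / INR (fact n))) with (x ^ n) in H by (field; lra).
exact H.
Qed.

(** With [x = / t] this is [x^n <= n! e^x], one term of the exponential series. *)
Lemma flat_bound (n : nat) (t : R) : 0 <= flat n t <= INR (fact n).
Proof.
assert (F : 0 < INR (fact n)) by apply INR_fact_lt_0.
unfold flat. destruct (Rle_dec t 0); [lra|].
assert (Ht : 0 < / t) by (apply Rinv_0_lt_compat; lra).
assert (H := pow_le_fact_exp n (/ t) (Rlt_le _ _ Ht)).
assert (E : exp (/ t) * exp (- / t) = 1) by (rewrite <- exp_plus, Rplus_opp_r; apply exp_0).
assert (0 < exp (- / t)) by apply exp_pos.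
assert (0 <= (/ t) ^ n) by (apply pow_le; lra).
split; [nra|].
apply (Rmult_le_compat_r (exp (- / t))) in H; [|lra].
rewrite Rmult_assoc, E in H. lra.
Qed.

Lemma flat_neg (n : nat) (t : R) : t <= 0 -> flat n t = 0.
Proof. intros H. unfold flat. now destruct (Rle_dec t 0). Qed.

Lemma flat_mult (n k : nat) (t : R) : t ^ k * flat (k + n) t = flat n t.
Proof.
unfold flat. destruct (Rle_dec t 0); [ring|].
rewrite pow_add, <- 2!Rmult_assoc, <- Rpow_mult_distr, Rinv_r by lra.
rewrite pow1. ring.
Qed.

Lemma flat_derive (n : nat) (t : R) :
  is_derive (flat n) t (flat (S (S n)) t - INR n * flat (S n) t).
Proof.
destruct (Rtotal_order t 0) as [H|[H|H]].
- rewrite !flat_neg by lra. replace (0 - _) with 0 by ring.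
  apply is_derive_ext_loc with (fun _ => 0).
  + apply (locally_interval _ t m_infty 0); try easy.
    intros y _ Hy. simpl in Hy. rewrite flat_neg; lra.
  + apply (is_derive_const (V := R_NormedModule)).
- subst t. rewrite !flat_neg by lra. replace (0 - _) with 0 by ring.
  apply is_derive_Reals. intros eps Heps.
  set (K := INR (fact (2 + n))).
  assert (HK : 0 < K) by apply INR_fact_lt_0.
  assert (Hd : 0 < eps / K) by (apply Rdiv_lt_0_compat; lra).
  exists (mkposreal _ Hd). intros h Hh Hl. simpl in Hl.
  rewrite Rplus_0_l, (flat_neg n 0) by lra.
  (* At the gluing point the difference quotient is [h * flat (2 + n) h], which is O(h) by
     [flat_bound]. *)
  rewrite <- (flat_mult n 2 h).
  replace ((h ^ 2 * flat (2 + n) h - 0) / h - 0) with (h * flat (2 + n) h) by (field; trivial).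
  destruct (flat_bound (2 + n) h) as [B0 B1]. fold K in B1.
  rewrite Rabs_mult, (Rabs_pos_eq _ B0).
  apply Rle_lt_trans with (Rabs h * K).
  + apply Rmult_le_compat_l; [apply Rabs_pos|trivial].
  + apply (Rmult_lt_compat_r K) in Hl; trivial.
    replace (eps / K * K) with eps in Hl by (field; lra). trivial.
- apply is_derive_ext_loc with (fun t => (/ t) ^ n * exp (- / t)).
  + apply (locally_interval _ t 0 p_infty); try easy.
    intros y Hy _. simpl in Hy. unfold flat. destruct (Rle_dec y 0); [lra|trivial].
  + unfold flat. destruct (Rle_dec t 0); [lra|].
    auto_derive; [repeat split; lra|].
    destruct n as [|n].
    * simpl. field. lra.
    * rewrite S_INR. simpl. field. lra.
Qed.

Lemma is_derive_Rmult (f g : R -> R) (x df dg : R) :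
  is_derive f x df -> is_derive g x dg ->
  is_derive (fun t => f t * g t) x (df * g x + f x * dg).
Proof. intros Hf Hg. exact (is_derive_mult f g x df dg Hf Hg Rmult_comm). Qed.

Lemma eta_flat (y : R) : eta y = flat 0 (y - 1) / (flat 0 (y - 1) + flat 0 (2 - y)).
Proof.
unfold eta, flat.
destruct (Rle_dec y 1), (Rle_dec (y - 1) 0); try lra.
destruct (Rle_dec 2 y), (Rle_dec (2 - y) 0); try lra.
- rewrite Rplus_0_r. unfold Rdiv. rewrite Rinv_r; trivial.
  generalize (exp_pos (- / (y - 1))). simpl. lra.
- simpl. rewrite !Rmult_1_l. unfold Rdiv.
  now replace (-1 * / (y - 1)) with (- / (y - 1)) by ring;
  replace (-1 * / (2 - y)) with (- / (2 - y)) by ring.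
Qed.

(** The two arguments add up to 1, so one of them is at least 1/2, where e^{-1/t} is at least
    e^{-2}. *)
Lemma flat_sum_lower (y : R) : exp (-2) <= flat 0 (y - 1) + flat 0 (2 - y).
Proof.
assert (H : forall t, 1 / 2 <= t -> exp (-2) <= flat 0 t).
{ intros t Ht. unfold flat. destruct (Rle_dec t 0); [lra|]. simpl. rewrite Rmult_1_l.
  assert (/ t <= 2) by (replace 2 with (/ (1 / 2)) by field; apply Rinv_le_contravar; lra).
  destruct (Req_dec (- / t) (-2)) as [->|]; [lra|]. apply Rlt_le, exp_increasing. lra. }
destruct (Rle_dec (1 / 2) (y - 1)) as [Hy|Hy].
- generalize (H (y - 1) Hy) (flat_bound 0 (2 - y)). lra.
- assert (Hy' : 1 / 2 <= 2 - y) by lra.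
  generalize (H (2 - y) Hy') (flat_bound 0 (y - 1)). lra.
Qed.

Lemma flat_left_derive (n : nat) (y : R) :
  is_derive (fun y => flat n (y - 1)) y
    (flat (S (S n)) (y - 1) - INR n * flat (S n) (y - 1)).
Proof.
evar_last.
- apply (is_derive_comp (V := R_NormedModule) (flat n) (fun y => y - 1)).
  + apply flat_derive.
  + auto_derive; trivial.
- unfold scal; simpl; unfold mult; simpl. ring.
Qed.

Lemma flat_right_derive (n : nat) (y : R) :
  is_derive (fun y => flat n (2 - y)) y
    (- (flat (S (S n)) (2 - y) - INR n * flat (S n) (2 - y))).
Proof.
evar_last.
- apply (is_derive_comp (V := R_NormedModule) (flat n) (fun y => 2 - y)).
  + apply flat_derive.
  + auto_derive; trivial.
- unfold scal; simpl; unfold mult; simpl. ring.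
Qed.

Lemma eta_range (y : R) : 0 <= eta y <= 1.
Proof.
rewrite eta_flat.
assert (H := flat_sum_lower y). assert (E := exp_pos (-2)).
destruct (flat_bound 0 (y - 1)) as [A _]. destruct (flat_bound 0 (2 - y)) as [B _].
split.
- apply Rmult_le_pos; trivial. apply Rlt_le, Rinv_0_lt_compat; lra.
- apply Rmult_le_reg_r with (flat 0 (y - 1) + flat 0 (2 - y)); [lra|].
  unfold Rdiv. rewrite Rmult_assoc, Rinv_l by lra. lra.
Qed.

Lemma eta_low (y : R) : y <= 1 -> eta y = 0.
Proof. intros H. unfold eta. now destruct (Rle_dec y 1). Qed.

(** In the quotient rule the terms with two factors at [y - 1] cancel, and the numerator [n] that
    remains is a sum of nonnegative products; hence [0 <= e1]. Each product in [n] and [n1] has one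
    factor at [y - 1] and one at [2 - y], so both vanish outside (1, 2). *)
Lemma eta_C2 : exists (e1 e2 : R -> R) (K : R), 0 < K /\
  (forall y, is_derive eta y (e1 y)) /\ (forall y, is_derive e1 y (e2 y)) /\
  (forall y, 0 <= e1 y <= K) /\ (forall y, Rabs (e2 y) <= K) /\
  (forall y, y <= 1 \/ 2 <= y -> e1 y = 0 /\ e2 y = 0).
Proof.
set (s := fun y => flat 0 (y - 1) + flat 0 (2 - y)).
set (s1 := fun y => flat 2 (y - 1) - flat 2 (2 - y)).
set (n := fun y => flat 2 (y - 1) * flat 0 (2 - y) + flat 0 (y - 1) * flat 2 (2 - y)).
set (n1 := fun y => (flat 4 (y - 1) - 2 * flat 3 (y - 1)) * flat 0 (2 - y)
                    - flat 0 (y - 1) * (flat 4 (2 - y) - 2 * flat 3 (2 - y))).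
assert (E := exp_pos (-2)).
assert (Sl : forall y, exp (-2) <= s y) by (intros y; apply flat_sum_lower).
assert (Sp : forall y, 0 < s y) by (intros y; specialize (Sl y); lra).
assert (Ds : forall y, is_derive s y (s1 y)).
{ intros y. evar_last.
  - apply (is_derive_plus (V := R_NormedModule)).
    + apply flat_left_derive.
    + apply flat_right_derive.
  - unfold plus, s1; simpl. ring. }
assert (Dn : forall y, is_derive n y (n1 y)).
{ intros y. evar_last.
  - apply (is_derive_plus (V := R_NormedModule)).
    + apply is_derive_Rmult; [apply flat_left_derive|apply flat_right_derive].
    + apply is_derive_Rmult; [apply flat_left_derive|apply flat_right_derive].
  - unfold plus, mult, n1; simpl. ring. }
set (e := exp (-2)) in *.
assert (B : forall k t, 0 <= flat k t <= INR (fact k)) by apply flat_bound.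
assert (L : forall y, y <= 1 \/ 2 <= y -> n y = 0 /\ n1 y = 0).
{ intros y [H|H]; unfold n, n1.
  - rewrite !(fun k => flat_neg k (y - 1)) by lra. split; ring.
  - rewrite !(fun k => flat_neg k (2 - y)) by lra. split; ring. }
assert (Bn : forall y, 0 <= n y <= 4).
{ intros y. unfold n.
  generalize (B 0%nat (y - 1)) (B 0%nat (2 - y)) (B 2%nat (y - 1)) (B 2%nat (2 - y)).
  simpl. intros.
  assert (flat 2 (y - 1) * flat 0 (2 - y) <= 2 * 1) by (apply Rmult_le_compat; lra).
  assert (flat 0 (y - 1) * flat 2 (2 - y) <= 1 * 2) by (apply Rmult_le_compat; lra).
  assert (0 <= flat 2 (y - 1) * flat 0 (2 - y)) by (apply Rmult_le_pos; lra).
  assert (0 <= flat 0 (y - 1) * flat 2 (2 - y)) by (apply Rmult_le_pos; lra).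
  lra. }
assert (Bn1 : forall y, Rabs (n1 y) <= 72).
{ intros y. unfold n1.
  assert (P : forall t, Rabs (flat 4 t - 2 * flat 3 t) <= 36).
  { intros t. generalize (B 3%nat t) (B 4%nat t). simpl. intros. apply Rabs_le. lra. }
  assert (Q : forall t, 0 <= flat 0 t <= 1) by (intros t; apply (B 0%nat t)).
  assert (T : forall t t', Rabs ((flat 4 t - 2 * flat 3 t) * flat 0 t') <= 36 * 1).
  { intros t t'. rewrite Rabs_mult, (Rabs_pos_eq (flat 0 t')) by apply Q.
    apply Rmult_le_compat; trivial; [apply Rabs_pos|apply Q|apply Q]. }
  generalize (T (y - 1) (2 - y)) (T (2 - y) (y - 1)). intros T1 T2.
  rewrite (Rmult_comm (flat 0 (y - 1))).
  eapply Rle_trans; [apply Rabs_triang|]. rewrite Rabs_Ropp. lra. }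
assert (Bs1 : forall y, Rabs (s1 y) <= 2).
{ intros y. unfold s1. generalize (B 2%nat (y - 1)) (B 2%nat (2 - y)).
  simpl. intros. apply Rabs_le. lra. }
assert (Bs : forall y, s y <= 2).
{ intros y. unfold s. generalize (B 0%nat (y - 1)) (B 0%nat (2 - y)). simpl. lra. }
exists (fun y => n y / s y ^ 2).
exists (fun y => (n1 y * s y ^ 2 - n y * (2 * s y * s1 y)) / (s y ^ 2) ^ 2).
(* The denominator [s] is at least [e]; [n] is at most 4, and the numerator of the second derivative
   is at most [72 * 4 + 2 * 16 = 320]. *)
exists (4 / e ^ 2 + 400 / (e ^ 2) ^ 2).
assert (Pe : 0 < e ^ 2) by (apply pow_lt; lra).
assert (Pe4 : 0 < (e ^ 2) ^ 2) by (apply pow_lt; lra).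
assert (Q1 : 0 < 4 / e ^ 2) by (apply Rdiv_lt_0_compat; lra).
assert (Q2 : 0 < 400 / (e ^ 2) ^ 2) by (apply Rdiv_lt_0_compat; lra).
assert (Sq : forall y, e ^ 2 <= s y ^ 2).
{ intros y. apply pow_incr. specialize (Sl y). lra. }
assert (Sq4 : forall y, (e ^ 2) ^ 2 <= (s y ^ 2) ^ 2).
{ intros y. apply pow_incr. specialize (Sq y). lra. }
split; [lra|]. split; [|split; [|split; [|split]]].
- intros y. apply (is_derive_ext (fun z => flat 0 (z - 1) / s z)).
  + intros t. now rewrite eta_flat.
  + evar_last.
    * apply is_derive_div; [apply flat_left_derive|apply Ds|].
      specialize (Sp y); lra.
    * unfold n, s1, s. simpl INR. f_equal. ring.
- intros y. evar_last.
  + apply is_derive_div; [apply Dn| |].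
    * apply (is_derive_pow s 2 y _ (Ds y)).
    * apply pow_nonzero. specialize (Sp y); lra.
  + f_equal. simpl. ring.
- intros y. destruct (Bn y) as [H H']. split.
  + apply Rmult_le_pos; trivial.
    apply Rlt_le, Rinv_0_lt_compat. specialize (Sq y); lra.
  + assert (n y / s y ^ 2 <= 4 / e ^ 2); [|lra].
    apply Rmult_le_compat; trivial.
    * apply Rlt_le, Rinv_0_lt_compat. specialize (Sq y); lra.
    * apply Rinv_le_contravar; [lra|apply Sq].
- intros y. unfold Rdiv. rewrite Rabs_mult, (Rabs_pos_eq (/ _)).
  2:{ apply Rlt_le, Rinv_0_lt_compat. specialize (Sq4 y); lra. }
  assert (Rabs (n1 y * s y ^ 2 - n y * (2 * s y * s1 y)) * / (s y ^ 2) ^ 2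
     <= 400 / (e ^ 2) ^ 2); [|lra].
  apply Rmult_le_compat; [apply Rabs_pos| | |].
  + apply Rlt_le, Rinv_0_lt_compat. specialize (Sq4 y); lra.
  + eapply Rle_trans; [apply Rabs_triang|]. rewrite Rabs_Ropp, !Rabs_mult.
    rewrite (Rabs_pos_eq (n y)), (Rabs_pos_eq (s y)), (Rabs_pos_eq 2),
      (Rabs_pos_eq (s y ^ 2)).
    * assert (s y ^ 2 <= 4) by (specialize (Bs y); specialize (Sp y); nra).
      assert (0 <= s y ^ 2) by apply pow2_ge_0.
      assert (U : Rabs (n1 y) * s y ^ 2 <= 72 * 4)
        by (apply Rmult_le_compat; trivial; apply Rabs_pos).
      assert (V : s y * Rabs (s1 y) <= 2 * 2)
        by (apply Rmult_le_compat; trivial; [apply Rlt_le, Sp|apply Rabs_pos]).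
      assert (W : n y * (s y * Rabs (s1 y)) <= 4 * (2 * 2)).
      { apply Rmult_le_compat; trivial; [apply Bn| |apply Bn].
        apply Rmult_le_pos; [apply Rlt_le, Sp|apply Rabs_pos]. }
      lra.
    * apply pow2_ge_0.
    * lra.
    * apply Rlt_le, Sp.
    * apply Bn.
  + apply Rinv_le_contravar; [lra|apply Sq4].
- intros y H. destruct (L y H) as [-> ->]. split; unfold Rdiv; ring.
Qed.

Lemma is_derive_MVT (f df : R -> R) (a b : R) : (forall x, is_derive f x (df x)) ->
  exists c, Rmin a b <= c <= Rmax a b /\ f b - f a = df c * (b - a).
Proof.
intros H. apply MVT_gen; intros x _; [apply H|].
apply derivable_continuous_pt. exists (df x). apply is_derive_Reals, H.
Qed.

Lemma eta_incr (x y : R) : x <= y -> eta x <= eta y.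
Proof.
intros H. destruct eta_C2 as (e1 & e2 & K & _ & D & _ & P & _).
destruct (is_derive_MVT _ _ x y D) as (c & _ & E).
destruct (P c) as [Pc _]. nra.
Qed.

(** For [x <= 0] the value of [Rpower] is a mere convention, but [psi (x / RR)] is 0 up to RR, so
    the product vanishes in a neighbourhood of any [x < RR]. For [x >= RR > 0] the product rule
    applies. *)
Lemma Rpower_dilate_derive (p RR : R) (psi psi1 : R -> R) : 0 < RR ->
  (forall y, is_derive psi y (psi1 y)) ->
  (forall y, y <= 1 -> psi y = 0 /\ psi1 y = 0) ->
  forall x, is_derive (fun x => Rpower x p * psi (x / RR)) x
    (p * (Rpower x (p - 1) * psi (x / RR)) + / RR * (Rpower x p * psi1 (x / RR))).
Proof.
intros HR D Z x.
assert (L : forall t, t <= RR -> t / RR <= 1).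
{ intros t Ht. apply Rmult_le_reg_r with RR; trivial. unfold Rdiv.
  rewrite Rmult_assoc, Rinv_l; lra. }
destruct (Rlt_dec x RR) as [Hx|Hx].
- destruct (Z (x / RR)) as [-> ->]; [apply L; lra|].
  replace (_ + _) with 0 by ring.
  apply is_derive_ext_loc with (fun _ => 0).
  + apply (locally_interval _ x m_infty RR); try easy.
    intros y _ Hy. simpl in Hy. destruct (Z (y / RR)) as [-> _]; [apply L; lra|].
    symmetry; apply Rmult_0_r.
  + apply (is_derive_const (V := R_NormedModule)).
- evar_last.
  + apply is_derive_Rmult.
    * apply is_derive_Reals, derivable_pt_lim_power. lra.
    * apply (is_derive_comp (V := R_NormedModule) psi (fun x => x / RR)); [apply D|].
      auto_derive; trivial.
  + unfold plus, mult, scal; simpl; unfold mult; simpl. field. lra.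
Qed.

(** Negative frequencies are included: [eta] is not even, so the weight is one-sided in spite of
    |xi|. *)
Lemma weight_low (s RR x : R) : 0 < RR -> x <= RR -> weight s RR x = 0.
Proof.
intros HR H. unfold weight. rewrite eta_low; [ring|].
apply Rmult_le_reg_r with RR; trivial. unfold Rdiv. rewrite Rmult_assoc, Rinv_l; lra.
Qed.

Lemma weight_Rpower (s RR x : R) : 0 < RR ->
  weight s RR x = Rpower x (2 * s) * eta (x / RR) ^ 2.
Proof.
intros HR. destruct (Rle_dec x RR) as [H|H].
- rewrite weight_low, eta_low; trivial; [ring|].
  apply Rmult_le_reg_r with RR; trivial. unfold Rdiv. rewrite Rmult_assoc, Rinv_l; lra.
- unfold weight, abspow. destruct (Req_EM_T x 0); [lra|]. now rewrite Rabs_pos_eq by lra.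
Qed.

Lemma jap_pos (x : R) : 1 <= jap x.
Proof. apply Rmax_l. Qed.

Lemma jap_ge (x : R) : Rabs x <= jap x.
Proof. apply Rmax_r. Qed.

Lemma jap_eq (x : R) : 1 <= x -> jap x = x.
Proof. intros H. unfold jap. rewrite Rabs_pos_eq by lra. now apply Rmax_right. Qed.

Lemma weight_bound (s RR x : R) : 0 < RR ->
  0 <= s -> 0 <= weight s RR x <= Rpower (jap x) (2 * s).
Proof.
intros HR Hs. assert (P : 0 < Rpower (jap x) (2 * s)) by apply exp_pos.
destruct (Rle_dec x RR) as [H|H]; [rewrite weight_low; lra|].
rewrite weight_Rpower by trivial.
assert (E := eta_range (x / RR)).
assert (Q : 0 < Rpower x (2 * s)) by apply exp_pos.
assert (U : Rpower x (2 * s) <= Rpower (jap x) (2 * s)).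
{ apply Rle_Rpower_l; [lra|]. split; [lra|].
  eapply Rle_trans; [apply Rle_abs|apply jap_ge]. }
assert (0 <= eta (x / RR) ^ 2 <= 1) by (split; [apply pow2_ge_0|nra]).
split; nra.
Qed.

(** The quotient [w(x) / x] is x^{2s-1} times [eta (x / RR) ^ 2], two nonnegative nondecreasing
    factors; the inequality is cross-multiplied. *)
Lemma weight_ratio (s RR a b : R) : 0 < RR -> 1 <= 2 * s -> 0 < a <= b ->
  b * weight s RR a <= weight s RR b * a.
Proof.
intros HR Hs [Ha Hb]. rewrite 2!weight_Rpower by trivial.
assert (T : forall x, 0 < x -> Rpower x (2 * s) = x * Rpower x (2 * s - 1)).
{ intros x Hx. rewrite <- (Rpower_1 x Hx) at 2. rewrite <- Rpower_plus. f_equal; ring. }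
rewrite (T a), (T b) by lra.
assert (U : Rpower a (2 * s - 1) <= Rpower b (2 * s - 1)) by (apply Rle_Rpower_l; lra).
assert (V : eta (a / RR) <= eta (b / RR)).
{ apply eta_incr, Rmult_le_compat_r; trivial. now apply Rlt_le, Rinv_0_lt_compat. }
assert (V2 : eta (a / RR) ^ 2 <= eta (b / RR) ^ 2).
{ apply pow_incr. split; trivial. apply eta_range. }
assert (W : Rpower a (2 * s - 1) * eta (a / RR) ^ 2
            <= Rpower b (2 * s - 1) * eta (b / RR) ^ 2).
{ apply Rmult_le_compat; trivial; [apply Rlt_le, exp_pos|apply pow2_ge_0]. }
assert (0 < b * a) by nra. nra.
Qed.

(** The factors [y] and [y ^ 2] make these bounds invariant under dilation, which is the source of
    uniformity in RR. The derivatives live on [1, 2], so the factors cost at most 2 and 4. *)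
Lemma eta_sq_C2 : exists (psi1 psi2 : R -> R) (K : R), 0 < K /\
  (forall y, is_derive (fun y => eta y ^ 2) y (psi1 y)) /\
  (forall y, is_derive psi1 y (psi2 y)) /\
  (forall y, y <= 1 -> psi1 y = 0 /\ psi2 y = 0) /\
  (forall y, Rabs (y * psi1 y) <= K) /\ (forall y, Rabs (y ^ 2 * psi2 y) <= K).
Proof.
destruct eta_C2 as (e1 & e2 & K & HK & D1 & D2 & B1 & B2 & L).
exists (fun y => 2 * eta y * e1 y), (fun y => 2 * e1 y ^ 2 + 2 * eta y * e2 y).
assert (C1 : forall y, Rabs (2 * eta y * e1 y) <= 2 * K).
{ intros y. destruct (eta_range y), (B1 y).
  rewrite Rabs_pos_eq by (repeat apply Rmult_le_pos; lra). nra. }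
assert (C2 : forall y, Rabs (2 * e1 y ^ 2 + 2 * eta y * e2 y) <= 2 * K ^ 2 + 2 * K).
{ intros y. destruct (eta_range y), (B1 y).
  eapply Rle_trans; [apply Rabs_triang|]. rewrite !Rabs_mult.
  rewrite (Rabs_pos_eq 2), (Rabs_pos_eq (_ ^ 2)), (Rabs_pos_eq (eta y))
    by (try apply pow2_ge_0; lra).
  assert (e1 y ^ 2 <= K ^ 2) by (apply pow_incr; lra).
  assert (eta y * Rabs (e2 y) <= 1 * K)
    by (apply Rmult_le_compat; trivial; apply Rabs_pos).
  lra. }
exists (4 * (2 * K ^ 2 + 2 * K)).
assert (K2 : 0 <= K ^ 2) by apply pow2_ge_0.
split; [lra|]. split; [|split; [|split; [|split]]].
- intros y. evar_last; [apply (is_derive_pow eta 2 y _ (D1 y))|]. simpl. ring.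
- intros y. evar_last.
  + apply is_derive_Rmult; [|apply D2].
    apply (is_derive_scal eta y 2 _ (D1 y)).
  + unfold plus, mult, scal; simpl; unfold mult; simpl. ring.
- intros y Hy. rewrite (eta_low y Hy). destruct (L y (or_introl Hy)) as [-> ->].
  split; ring.
- intros y. destruct (Rle_dec y 1) as [H|H]; [|destruct (Rle_dec 2 y) as [H'|H']].
  + destruct (L y (or_introl H)) as [-> _]. rewrite 2!Rmult_0_r, Rabs_R0. lra.
  + destruct (L y (or_intror H')) as [-> _]. rewrite 2!Rmult_0_r, Rabs_R0. lra.
  + rewrite Rabs_mult, (Rabs_pos_eq y) by lra. specialize (C1 y).
    assert (y * Rabs (2 * eta y * e1 y) <= 2 * (2 * K))
      by (apply Rmult_le_compat; trivial; [lra|apply Rabs_pos|lra]).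
    lra.
- intros y. destruct (Rle_dec y 1) as [H|H]; [|destruct (Rle_dec 2 y) as [H'|H']].
  + destruct (L y (or_introl H)) as [-> ->].
    replace (y ^ 2 * _) with 0 by ring. rewrite Rabs_R0. lra.
  + destruct (L y (or_intror H')) as [-> ->].
    replace (y ^ 2 * _) with 0 by ring. rewrite Rabs_R0. lra.
  + rewrite Rabs_mult, (Rabs_pos_eq (y ^ 2)) by apply pow2_ge_0.
    apply Rmult_le_compat; trivial; [apply pow2_ge_0|apply Rabs_pos|nra].
Qed.

(** With [p = 2 s] and [y = x / RR], x^2 w'' equals x^p times
    [p (p - 1) eta^2 + 2 p y psi1 + y^2 psi2], where psi1 and psi2 are the derivatives of eta^2. RR
    enters only through [y], so [K] can be chosen before it. *)
Lemma weight_C2 (s : R) : 0 <= s -> exists K, 0 < K /\ forall RR, 1 < RR ->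
  exists w1 w2 : R -> R,
    (forall x, is_derive (weight s RR) x (w1 x)) /\
    (forall x, is_derive w1 x (w2 x)) /\
    (forall x, x <= RR -> w2 x = 0) /\
    (forall x, jap x ^ 2 * Rabs (w2 x) <= K * Rpower (jap x) (2 * s)).
Proof.
intros Hs. destruct eta_sq_C2 as (f1 & f2 & K & HK & D1 & D2 & L & B1 & B2).
set (p := 2 * s).
exists (p * Rabs (p - 1) + 2 * (p * K) + K).
assert (Hp : 0 <= p) by (unfold p; lra).
assert (Hpp : 0 <= p * Rabs (p - 1)) by (apply Rmult_le_pos; [trivial|apply Rabs_pos]).
assert (HpK : 0 <= p * K) by (apply Rmult_le_pos; lra).
split; [lra|]. intros RR HR.
assert (HR0 : 0 < RR) by lra.
assert (L0 : forall y, y <= 1 -> eta y ^ 2 = 0 /\ f1 y = 0).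
{ intros y Hy. rewrite (eta_low y Hy). destruct (L y Hy) as [-> _]. split; ring. }
set (f0 := fun y => eta y ^ 2) in *.
exists (fun x => p * (Rpower x (p - 1) * f0 (x / RR)) + / RR * (Rpower x p * f1 (x / RR))).
exists (fun x => p * ((p - 1) * (Rpower x (p - 1 - 1) * f0 (x / RR))
                      + / RR * (Rpower x (p - 1) * f1 (x / RR)))
              + / RR * (p * (Rpower x (p - 1) * f1 (x / RR))
                      + / RR * (Rpower x p * f2 (x / RR)))).
assert (Lo : forall x, x <= RR -> x / RR <= 1).
{ intros t Ht. apply Rmult_le_reg_r with RR; trivial. unfold Rdiv.
  rewrite Rmult_assoc, Rinv_l; lra. }
assert (Z2 : forall x, x <= RR -> p * ((p - 1) * (Rpower x (p - 1 - 1) * f0 (x / RR))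
                      + / RR * (Rpower x (p - 1) * f1 (x / RR)))
              + / RR * (p * (Rpower x (p - 1) * f1 (x / RR))
                      + / RR * (Rpower x p * f2 (x / RR))) = 0).
{ intros x Hx. destruct (L0 (x / RR) (Lo x Hx)) as [E0 _].
  change (f0 (x / RR) = 0) in E0.
  destruct (L (x / RR) (Lo x Hx)) as [-> ->]. rewrite E0. ring. }
split; [|split; [|split]]; trivial.
- intros x. apply (is_derive_ext (fun x => Rpower x p * f0 (x / RR))).
  + intros t. now rewrite weight_Rpower.
  + now apply Rpower_dilate_derive.
- intros x. apply (is_derive_plus (V := R_NormedModule)).
  + apply is_derive_scal. now apply Rpower_dilate_derive.
  + apply is_derive_scal. now apply Rpower_dilate_derive.
- intros x. assert (P : 0 < Rpower (jap x) p) by apply exp_pos.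
  destruct (Rle_dec x RR) as [Hx|Hx].
  + rewrite Z2, Rabs_R0 by trivial. rewrite Rmult_0_r.
    apply Rmult_le_pos; lra.
  + rewrite jap_eq in * by lra.
    rewrite <- (Rabs_pos_eq (x ^ 2)), <- Rabs_mult by apply pow2_ge_0.
    assert (T1 : x * Rpower x (p - 1) = Rpower x p).
    { rewrite <- (Rpower_1 x) at 1 by lra. rewrite <- Rpower_plus. f_equal; ring. }
    assert (T2 : x * Rpower x (p - 1 - 1) = Rpower x (p - 1)).
    { rewrite <- (Rpower_1 x) at 1 by lra. rewrite <- Rpower_plus. f_equal; ring. }
    set (y := x / RR). specialize (B1 y). specialize (B2 y).
    assert (F : 0 <= f0 y <= 1).
    { unfold f0. destruct (eta_range y). split; [apply pow2_ge_0|nra]. }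
    replace (x ^ 2 * _) with (Rpower x p *
      (p * (p - 1) * f0 y + 2 * p * (y * f1 y) + y ^ 2 * f2 y)).
    * rewrite Rabs_mult, (Rabs_pos_eq (Rpower x p)), (Rmult_comm _ (Rpower x p)) by lra.
      apply Rmult_le_compat_l; [lra|].
      eapply Rle_trans; [apply Rabs_triang|]. apply Rplus_le_compat; trivial.
      eapply Rle_trans; [apply Rabs_triang|].
      rewrite !(Rabs_mult _ (f0 y)), !(Rabs_mult _ (y * f1 y)), !Rabs_mult,
        (Rabs_pos_eq p), (Rabs_pos_eq 2), (Rabs_pos_eq (f0 y)) by lra.
      rewrite Rabs_mult in B1.
      assert (p * Rabs (p - 1) * f0 y <= p * Rabs (p - 1) * 1)
        by (apply Rmult_le_compat_l; lra).
      assert (p * (Rabs y * Rabs (f1 y)) <= p * K) by (apply Rmult_le_compat_l; lra).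
      lra.
    * rewrite <- T1, <- T2. unfold y. field. lra.
Qed.

(** * Row inequalities *)

(** A row of the commutator evaluates the weight at distances 1 and 3, hence the range of [h]; the
    factor is [1 + 3], because [jap] is at least 1. *)
Lemma jap_shift (x h : R) : Rabs h <= 3 -> jap (x + h) <= 4 * jap x.
Proof.
intros H. unfold jap at 1. assert (P := jap_pos x). assert (Q := jap_ge x).
apply Rmax_lub; [lra|]. eapply Rle_trans; [apply Rabs_triang|]. lra.
Qed.

Lemma jap_unshift (x h : R) : Rabs h <= 3 -> jap x <= 4 * jap (x + h).
Proof.
intros H. replace x with (x + h + - h) at 1 by ring.
apply jap_shift. now rewrite Rabs_Ropp.
Qed.

Lemma jap_power_shift (p x h : R) : 0 <= p -> Rabs h <= 3 ->
  Rpower (jap (x + h)) p <= Rpower 4 p * Rpower (jap x) p.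
Proof.
intros Hp H. assert (P := jap_pos x). assert (Q := jap_pos (x + h)).
rewrite Rpower_mult_distr by lra. apply Rle_Rpower_l; trivial.
split; [lra|now apply jap_shift].
Qed.

(** Applying the mean value theorem twice writes the remainder as [w2 t * ((c - x) * h)] with [t]
    within 3 of [x]. It vanishes for [t <= RR]; otherwise [t] dominates both RR and [jap x / 4]. The
    decay t^{-2} of [w2] relative to the power is spent twice on RR in the first bound, and once on
    RR and once on [jap x] in the second. *)
Lemma weight_taylor (s : R) : 0 <= s -> exists K, 0 < K /\ forall RR, 1 < RR ->
  exists w1 : R -> R, forall x h, Rabs h <= 3 ->
    Rabs (weight s RR (x + h) - weight s RR x - h * w1 x)
      <= K * (Rpower (jap x) (2 * s) / RR ^ 2) /\
    jap x * Rabs (weight s RR (x + h) - weight s RR x - h * w1 x)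
      <= K * (Rpower (jap x) (2 * s) / RR).
Proof.
intros Hs. destruct (weight_C2 s Hs) as (K & HK & W).
set (Q := Rpower 4 (2 * s)). assert (HQ : 0 < Q) by apply exp_pos.
assert (HKQ : 0 < K * Q) by (apply Rmult_lt_0_compat; lra).
(* 36 is 9 from [(c - x) * h] times 4 from [jap x <= 4 * t]; [Q] pays for moving the power from [t]
   to [x]. *)
exists (36 * (K * Q)). split; [lra|]. intros RR HR.
destruct (W RR HR) as (w1 & w2 & D1 & D2 & Z & B). exists w1. intros x h Hh.
destruct (is_derive_MVT _ _ x (x + h) D1) as (c & Hc & Ec).
destruct (is_derive_MVT _ _ x c D2) as (t & Ht & Et).
assert (Ac : Rabs (c - x) <= 3).
{ apply Rabs_le. apply Rabs_le_between in Hh. revert Hc.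
  unfold Rmin, Rmax; destruct (Rle_dec x (x + h)); lra. }
assert (At : Rabs (t - x) <= 3).
{ apply Rabs_le. apply Rabs_le_between in Ac. revert Ht.
  unfold Rmin, Rmax; destruct (Rle_dec x c); lra. }
set (X := Rpower (jap x) (2 * s)). assert (HX : 0 < X) by apply exp_pos.
assert (E : weight s RR (x + h) - weight s RR x - h * w1 x = w2 t * ((c - x) * h)).
{ rewrite Ec. replace (x + h - x) with h by ring.
  replace (w1 c * h - h * w1 x) with ((w1 c - w1 x) * h) by ring. rewrite Et. ring. }
rewrite E, Rabs_mult.
assert (A9 : Rabs ((c - x) * h) <= 9).
{ rewrite Rabs_mult. replace 9 with (3 * 3) by ring.
  apply Rmult_le_compat; trivial; apply Rabs_pos. }
assert (HXR : 0 < X / RR) by (apply Rdiv_lt_0_compat; lra).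
assert (HXR2 : 0 < X / RR ^ 2) by (apply Rdiv_lt_0_compat; [lra|apply pow_lt; lra]).
destruct (Rle_dec t RR) as [HtR|HtR].
{ rewrite (Z t HtR), Rabs_R0, Rmult_0_l, Rmult_0_r.
  split; apply Rmult_le_pos; lra. }
assert (Jt : jap t = t) by (apply jap_eq; lra).
assert (Bt := B t).
assert (J : jap x <= 4 * t).
{ rewrite <- Jt at 1. replace t with (x + (t - x)) by ring. now apply jap_unshift. }
assert (Xt : Rpower (jap t) (2 * s) <= Q * X).
{ replace t with (x + (t - x)) by ring. apply jap_power_shift; trivial. lra. }
rewrite Jt in Bt, Xt. set (v := Rabs (w2 t)) in *.
assert (Hv : 0 <= v) by apply Rabs_pos.
assert (Bt' : t ^ 2 * v <= (K * Q) * X) by nra.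
assert (Jx := jap_pos x).
assert (V2 : v <= K * Q * (X / RR ^ 2)).
{ apply Rmult_le_reg_l with (RR ^ 2); [apply pow_lt; lra|].
  replace (RR ^ 2 * (K * Q * (X / RR ^ 2))) with (K * Q * X) by (field; lra).
  assert (RR ^ 2 <= t ^ 2) by (apply pow_incr; lra). nra. }
assert (V1 : t * v <= K * Q * (X / RR)).
{ apply Rmult_le_reg_l with RR; [lra|].
  replace (RR * (K * Q * (X / RR))) with (K * Q * X) by (field; lra).
  assert (0 <= t * v) by nra. nra. }
assert (v * Rabs ((c - x) * h) <= v * 9) by (apply Rmult_le_compat_l; trivial).
split.
- assert (0 < K * Q * (X / RR ^ 2)) by (apply Rmult_lt_0_compat; trivial). lra.
- assert (jap x * (v * Rabs ((c - x) * h)) <= (4 * t) * (v * 9)).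
  { apply Rmult_le_compat; trivial; [lra|]. apply Rmult_le_pos; trivial. apply Rabs_pos. }
  lra.
Qed.

(** Multiplying the weight by a factor decaying like [jap x ^ -2] gains [RR ^ -2],
    because the weight lives on frequencies above [RR]. *)
Lemma weight_absorb (s : R) : 0 <= s -> exists K, 0 < K /\
  forall RR x h kap L, 1 < RR -> Rabs h <= 3 -> jap x ^ 2 * Rabs kap <= L ->
    Rabs kap * weight s RR (x + h) <= K * L * (Rpower (jap x) (2 * s) / RR ^ 2) /\
    jap x * (Rabs kap * weight s RR (x + h)) <= K * L * (Rpower (jap x) (2 * s) / RR).
Proof.
intros Hs. set (Q := Rpower 4 (2 * s)). assert (HQ : 0 < Q) by apply exp_pos.
exists (16 * Q). split; [lra|]. intros RR x h kap L HR Hh HL.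
set (X := Rpower (jap x) (2 * s)). assert (HX : 0 < X) by apply exp_pos.
assert (Jx := jap_pos x). set (j := jap x) in *.
assert (Hk := Rabs_pos kap). set (v := Rabs kap) in *.
assert (HL0 : 0 <= L) by (eapply Rle_trans; [|apply HL]; apply Rmult_le_pos; [apply pow2_ge_0|lra]).
assert (HXR : 0 < X / RR) by (apply Rdiv_lt_0_compat; lra).
assert (HXR2 : 0 < X / RR ^ 2) by (apply Rdiv_lt_0_compat; [lra|apply pow_lt; lra]).
destruct (Rle_dec (x + h) RR) as [H|H].
{ rewrite weight_low, !Rmult_0_r by lra.
  split; apply Rmult_le_pos; try lra; apply Rmult_le_pos; lra. }
assert (W := weight_bound s RR (x + h) ltac:(lra) Hs).
assert (WX : Rpower (jap (x + h)) (2 * s) <= Q * X) by (apply jap_power_shift; lra).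
assert (RJ : RR <= 4 * j).
{ assert (S := jap_shift x h Hh). assert (G := jap_ge (x + h)).
  assert (G' := Rle_abs (x + h)). fold j in S. lra. }
set (w := weight s RR (x + h)) in *.
assert (P1 : RR * (j * v) <= 16 * L).
{ assert (RR * (j * v) <= (4 * j) * (j * v)) by (apply Rmult_le_compat_r; [nra|lra]). nra. }
assert (P2 : RR ^ 2 * v <= 16 * L).
{ assert (RR ^ 2 <= (4 * j) ^ 2) by (apply pow_incr; lra).
  assert (RR ^ 2 * v <= (4 * j) ^ 2 * v) by (apply Rmult_le_compat_r; lra). nra. }
split.
- apply Rmult_le_reg_l with (RR ^ 2); [apply pow_lt; lra|].
  replace (RR ^ 2 * (16 * Q * L * (X / RR ^ 2))) with (16 * L * (Q * X)) by (field; lra).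
  rewrite <- Rmult_assoc. apply Rmult_le_compat; trivial; try lra.
  apply Rmult_le_pos; [apply pow2_ge_0|lra].
- apply Rmult_le_reg_l with RR; [lra|].
  replace (RR * (16 * Q * L * (X / RR))) with (16 * L * (Q * X)) by (field; lra).
  rewrite <- (Rmult_assoc j), <- Rmult_assoc. apply Rmult_le_compat; trivial; try lra.
  apply Rmult_le_pos; [lra|apply Rmult_le_pos; lra].
Qed.

(** [chi 2 x] is 1 once [jap x >= 4 / delta0], so [chi 2 x - 1] is compactly supported and decays at
    any rate; the quadratic one is what [weight_absorb] takes. *)
Lemma cutoff_near_one (delta0 : R) (chi : R -> R -> R) (Hchi : BW_cutoff delta0 chi) :
  exists L, 0 < L /\ forall x, Rabs (chi 2 x) <= L /\ jap x ^ 2 * Rabs (chi 2 x - 1) <= L.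
Proof.
destruct (cutoff_bound _ _ Hchi 0 0) as [K B]. simpl in B.
assert (HB : forall x, Rabs (chi 2 x) <= K).
{ intros x. specialize (B 2 x). rewrite Rplus_0_r, Ropp_0, Rpower_O in B.
  - lra.
  - assert (P := jap_pos x). lra. }
assert (HK : 0 <= K) by (eapply Rle_trans; [apply Rabs_pos|apply (HB 0)]).
destruct (cutoff_delta _ _ Hchi) as [D _].
set (M := 4 / delta0). assert (HM : 0 < M) by (apply Rdiv_lt_0_compat; lra).
exists (K + 1 + M ^ 2 * (K + 1)).
assert (0 < M ^ 2) by (apply pow_lt; lra).
assert (0 < M ^ 2 * (K + 1)) by (apply Rmult_lt_0_compat; lra).
split; [lra|]. intros x. split; [specialize (HB x); lra|].
destruct (Rle_dec M (jap x)) as [HJ|HJ].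
- rewrite (cutoff_one _ _ Hchi 2).
  + rewrite Rminus_diag, Rabs_R0. lra.
  + rewrite Rabs_pos_eq by lra. apply (Rmult_le_compat_l delta0) in HJ; [|lra].
    unfold M in HJ. replace (delta0 * (4 / delta0)) with 4 in HJ by (field; lra). lra.
- assert (P := jap_pos x).
  assert (jap x ^ 2 * Rabs (chi 2 x - 1) <= M ^ 2 * (K + 1)); [|lra].
  apply Rmult_le_compat; [apply pow2_ge_0|apply Rabs_pos|apply pow_incr; lra|].
  unfold Rminus. eapply Rle_trans; [apply Rabs_triang|].
  rewrite Rabs_Ropp, Rabs_R1. specialize (HB x). lra.
Qed.

(** Equal shifts serve the squares on the diagonal of the commutator, distinct ones its entries at
    distance 4. *)
Lemma cutoff_products_near_one (delta0 : R) (chi : R -> R -> R)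
    (Hchi : BW_cutoff delta0 chi) :
  exists L, 0 < L /\ forall x h h', Rabs h <= 3 -> Rabs h' <= 3 ->
    jap x ^ 2 * Rabs (chi 2 (x + h) - 1) <= L /\
    jap x ^ 2 * Rabs (chi 2 (x + h) * chi 2 (x + h') - 1) <= L.
Proof.
destruct (cutoff_near_one _ _ Hchi) as (L & HL & B).
assert (S : forall x h, Rabs h <= 3 -> jap x ^ 2 * Rabs (chi 2 (x + h) - 1) <= 16 * L).
{ intros x h Hh. destruct (B (x + h)) as [_ B2].
  assert (J := jap_unshift x h Hh). assert (P := jap_pos x).
  assert (jap x ^ 2 <= (4 * jap (x + h)) ^ 2) by (apply pow_incr; lra).
  assert (Q := Rabs_pos (chi 2 (x + h) - 1)). nra. }
exists (16 * L * L + 16 * L).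
assert (0 < L * L) by (apply Rmult_lt_0_compat; lra).
split; [lra|]. intros x h h' Hh Hh'. split.
- specialize (S x h Hh). lra.
- replace (chi 2 (x + h) * chi 2 (x + h') - 1)
    with ((chi 2 (x + h) - 1) * chi 2 (x + h') + (chi 2 (x + h') - 1)) by ring.
  assert (P : 0 <= jap x ^ 2) by apply pow2_ge_0.
  assert (S1 := S x h Hh). assert (S2 := S x h' Hh').
  assert (T := Rabs_triang ((chi 2 (x + h) - 1) * chi 2 (x + h')) (chi 2 (x + h') - 1)).
  rewrite Rabs_mult in T. apply (Rmult_le_compat_l _ _ _ P) in T.
  assert (U : (jap x ^ 2 * Rabs (chi 2 (x + h) - 1)) * Rabs (chi 2 (x + h')) <= (16 * L) * L).
  { apply Rmult_le_compat; trivial; [|apply Rabs_pos|apply B].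
    apply Rmult_le_pos; [trivial|apply Rabs_pos]. }
  lra.
Qed.

Lemma Rabs_le_near_one (c w : R) : 0 <= w -> Rabs c * w <= w + Rabs (c - 1) * w.
Proof.
intros Hw. assert (T := Rabs_triang (c - 1) 1). rewrite Rabs_R1 in T.
replace (c - 1 + 1) with c in T by ring. nra.
Qed.

(** The sample points are symmetric about [x], so the first-order terms cancel. No frequency
    multiplies the errors, which therefore keep the full gain RR^{-2}. *)
Lemma hop1_row_bound (delta0 : R) (chi : R -> R -> R) (Hchi : BW_cutoff delta0 chi)
    (s : R) : 0 <= s -> exists C, 0 < C /\ forall RR x, 1 < RR ->
  Rabs (chi 2 (x - 1)) * weight s RR (x - 1) + Rabs (chi 2 (x + 1)) * weight s RR (x + 1)
    <= 2 * weight s RR x + C * (Rpower (jap x) (2 * s) / RR ^ 2).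
Proof.
intros Hs.
destruct (weight_taylor s Hs) as (K1 & HK1 & T).
destruct (weight_absorb s Hs) as (K2 & HK2 & A).
destruct (cutoff_products_near_one _ _ Hchi) as (L & HL & B).
assert (0 < K2 * L) by (apply Rmult_lt_0_compat; lra).
exists (2 * K1 + 2 * (K2 * L)). split; [lra|]. intros RR x HR.
destruct (T RR HR) as (w1 & T').
assert (A1 : Rabs 1 <= 3) by (apply Rabs_le; lra).
assert (Am1 : Rabs (-1) <= 3) by (apply Rabs_le; lra).
destruct (T' x 1 A1) as [T1 _]. destruct (T' x (-1) Am1) as [T2 _].
destruct (A RR x 1 _ L HR A1 (proj1 (B x 1 1 A1 A1))) as [E1 _].
destruct (A RR x (-1) _ L HR Am1 (proj1 (B x (-1) 1 Am1 A1))) as [E2 _].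
change (x - 1) with (x + -1).
assert (W1 := weight_bound s RR (x + 1) ltac:(lra) Hs).
assert (W2 := weight_bound s RR (x + -1) ltac:(lra) Hs).
assert (N1 := Rabs_le_near_one (chi 2 (x + 1)) _ (proj1 W1)).
assert (N2 := Rabs_le_near_one (chi 2 (x + -1)) _ (proj1 W2)).
apply Rabs_le_between in T1. apply Rabs_le_between in T2. lra.
Qed.

(** A discrete form of [2 (x w' - w)], that is, 2 x^2 times the derivative of [w / x]. *)
Definition gam (s RR x : R) : R :=
  weight s RR (x + 1) * (x - 1) - (x + 1) * weight s RR (x - 1).

(** Integrality matters: for real [x] in (0, 1) the factor [x - 1] is negative while [x + 1] may
    exceed RR. At integers, [k >= 2] follows from [weight_ratio], [k = 1] makes [x - 1] zero, and
    for [k <= 0] both weights vanish. *)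
Lemma gam_nonneg (s RR : R) (k : Z) : 1 <= 2 * s -> 1 < RR -> 0 <= gam s RR (IZR k).
Proof.
intros Hs HR. unfold gam.
destruct (Z_le_dec k 1) as [Hk|Hk].
- rewrite (weight_low s RR (IZR k - 1)).
  + destruct (Z.eq_dec k 1) as [->|Hk1]; [lra|].
    rewrite weight_low; [lra|lra|].
    assert (k <= 0)%Z by lia. apply IZR_le in H. lra.
  + lra.
  + apply IZR_le in Hk. lra.
- assert (H : (2 <= k)%Z) by lia. apply IZR_le in H.
  assert (W := weight_ratio s RR (IZR k - 1) (IZR k + 1) ltac:(lra) Hs ltac:(lra)). lra.
Qed.

(** The crude size [6 j (w + w')] is used only behind the factor [kap - 1], whose decay compensates
    the frequency [j]; the main part keeps coefficient exactly 1. *)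
Lemma gam_cutoff_bound (j kap x w w' : R) : 0 <= w -> 0 <= w' ->
  Rabs (x - 1) <= 6 * j -> Rabs (x + 1) <= 6 * j -> 0 <= w * (x - 1) - (x + 1) * w' ->
  Rabs kap * (w * (x - 1) - (x + 1) * w') <= (w * (x - 1) - (x + 1) * w')
    + 6 * (j * (Rabs (kap - 1) * w)) + 6 * (j * (Rabs (kap - 1) * w')).
Proof.
intros Hw Hw' H1 H2 Hg. assert (N := Rabs_le_near_one kap _ Hg).
apply Rabs_le_between in H1. apply Rabs_le_between in H2.
assert (w * (x - 1) - (x + 1) * w' <= 6 * j * w + 6 * j * w') by nra.
assert (P := Rabs_pos (kap - 1)).
assert (Rabs (kap - 1) * (w * (x - 1) - (x + 1) * w')
  <= Rabs (kap - 1) * (6 * j * w + 6 * j * w')) by (apply Rmult_le_compat_l; trivial).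
lra.
Qed.

(** Expanding at [x] with the cut-offs set to 1, the diagonal gives [2 w + 2 x w1] and each [gam]
    gives [-2 w + 2 x w1]. Subtracting the two halves leaves [4 w] and no [w1]. *)
Lemma commutator_row_bound (delta0 : R) (chi : R -> R -> R) (Hchi : BW_cutoff delta0 chi)
    (s : R) : 1 <= 2 * s -> exists C, 0 < C /\ forall RR (k : Z), 1 < RR ->
  let x := IZR k in
  4 * weight s RR x
    <= chi 2 (x + 1) ^ 2 * weight s RR (x + 1) * (x + 1)
       - chi 2 (x - 1) ^ 2 * weight s RR (x - 1) * (x - 1)
       - / 2 * (Rabs (chi 2 (x + 3) * chi 2 (x + 1)) * gam s RR (x + 2))
       - / 2 * (Rabs (chi 2 (x - 1) * chi 2 (x - 3)) * gam s RR (x - 2))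
       + C * (Rpower (jap x) (2 * s) / RR).
Proof.
intros Hs2. assert (Hs : 0 <= s) by lra.
destruct (weight_taylor s Hs) as (K1 & HK1 & T).
destruct (weight_absorb s Hs) as (K2 & HK2 & A).
destruct (cutoff_products_near_one _ _ Hchi) as (L & HL & B).
assert (0 < K2 * L) by (apply Rmult_lt_0_compat; lra).
(* Taylor remainders cost 4 on the diagonal and 3 for each halved [gam]; cut-off errors cost 2 + 2
   on the diagonal and 6 + 6 in the [gam] terms, which 20 covers. *)
exists (10 * K1 + 20 * (K2 * L)). split; [lra|]. intros RR k HR x.
destruct (T RR HR) as (w1 & T').
assert (A1 : Rabs 1 <= 3) by (apply Rabs_le; lra).
assert (Am1 : Rabs (-1) <= 3) by (apply Rabs_le; lra).
assert (A3 : Rabs 3 <= 3) by (apply Rabs_le; lra).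
assert (Am3 : Rabs (-3) <= 3) by (apply Rabs_le; lra).
assert (J1 := jap_pos x). assert (Jx := jap_ge x).
set (E := Rpower (jap x) (2 * s) / RR).
(* The remainders are multiplied by [x] plus a constant, so each is bounded both alone and times
   [x]. *)
assert (TJ : forall h, Rabs h <= 3 -> let t := weight s RR (x + h) - weight s RR x - h * w1 x in
  - (K1 * E) <= x * t <= K1 * E /\ - (K1 * E) <= t <= K1 * E).
{ intros h Hh t. destruct (T' x h Hh) as [_ U]. fold t E in U.
  assert (P := Rabs_pos t). split; apply Rabs_le_between.
  - rewrite Rabs_mult. eapply Rle_trans; [|apply U]. now apply Rmult_le_compat_r.
  - eapply Rle_trans; [|apply U]. nra. }
assert (AB : forall h h' h'', Rabs h <= 3 -> Rabs h' <= 3 -> Rabs h'' <= 3 ->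
  jap x * (Rabs (chi 2 (x + h) * chi 2 (x + h') - 1) * weight s RR (x + h'')) <= K2 * L * E).
{ intros h h' h'' H1 H2 H3.
  exact (proj2 (A RR x h'' _ L HR H3 (proj2 (B x h h' H1 H2)))). }
assert (WP : forall y, 0 <= weight s RR y).
{ intros y. apply weight_bound; lra. }
apply Rabs_le_between in Jx.
assert (D1 : weight s RR (x + 1) * (x + 1) - 2 * (K2 * L * E)
  <= chi 2 (x + 1) ^ 2 * weight s RR (x + 1) * (x + 1)).
{ specialize (AB 1 1 1 A1 A1 A1). specialize (WP (x + 1)).
  set (c := chi 2 (x + 1)) in *. set (w := weight s RR (x + 1)) in *.
  replace (c ^ 2 * w * (x + 1)) with (w * (x + 1) + (c * c - 1) * w * (x + 1)) by ring.
  assert (Rabs ((c * c - 1) * w * (x + 1)) <= 2 * (jap x * (Rabs (c * c - 1) * w))).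
  { rewrite !Rabs_mult, (Rabs_pos_eq w) by trivial.
    assert (Rabs (x + 1) <= 2 * jap x) by (apply Rabs_le; lra).
    assert (0 <= Rabs (c * c - 1) * w) by (apply Rmult_le_pos; [apply Rabs_pos|trivial]).
    nra. }
  apply Rabs_le_between in H0. lra. }
assert (D2 : chi 2 (x - 1) ^ 2 * weight s RR (x - 1) * (x - 1)
  <= weight s RR (x - 1) * (x - 1) + 2 * (K2 * L * E)).
{ specialize (AB (-1) (-1) (-1) Am1 Am1 Am1). specialize (WP (x + -1)).
  change (x + -1) with (x - 1) in *.
  set (c := chi 2 (x - 1)) in *. set (w := weight s RR (x - 1)) in *.
  replace (c ^ 2 * w * (x - 1)) with (w * (x - 1) + (c * c - 1) * w * (x - 1)) by ring.
  assert (Rabs ((c * c - 1) * w * (x - 1)) <= 2 * (jap x * (Rabs (c * c - 1) * w))).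
  { rewrite !Rabs_mult, (Rabs_pos_eq w) by trivial.
    assert (Rabs (x - 1) <= 2 * jap x) by (apply Rabs_le; lra).
    assert (0 <= Rabs (c * c - 1) * w) by (apply Rmult_le_pos; [apply Rabs_pos|trivial]).
    nra. }
  apply Rabs_le_between in H0. lra. }
assert (G1 := gam_nonneg s RR (k + 2) Hs2 HR).
assert (G2 := gam_nonneg s RR (k - 2) Hs2 HR).
rewrite plus_IZR in G1. rewrite minus_IZR in G2. fold x in G1, G2. unfold gam in *.
replace (x + 2 + 1) with (x + 3) in * by ring.
replace (x + 2 - 1) with (x + 1) in * by ring.
replace (x - 2 + 1) with (x - 1) in * by ring.
replace (x - 2 - 1) with (x - 3) in * by ring.
assert (C1 := gam_cutoff_bound (jap x) (chi 2 (x + 3) * chi 2 (x + 1)) (x + 2) _ _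
  (WP (x + 3)) (WP (x + 1)) ltac:(apply Rabs_le; lra) ltac:(apply Rabs_le; lra)).
assert (C2 := gam_cutoff_bound (jap x) (chi 2 (x - 1) * chi 2 (x - 3)) (x - 2) _ _
  (WP (x - 1)) (WP (x - 3)) ltac:(apply Rabs_le; lra) ltac:(apply Rabs_le; lra)).
replace (x + 2 + 1) with (x + 3) in * by ring.
replace (x + 2 - 1) with (x + 1) in * by ring.
replace (x - 2 + 1) with (x - 1) in * by ring.
replace (x - 2 - 1) with (x - 3) in * by ring.
specialize (C1 G1). specialize (C2 G2).
assert (B1 := AB 3 1 3 A3 A1 A3). assert (B2 := AB 3 1 1 A3 A1 A1).
assert (B3 := AB (-1) (-3) (-1) Am1 Am3 Am1). assert (B4 := AB (-1) (-3) (-3) Am1 Am3 Am3).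
destruct (TJ 1 A1) as [U1 V1]. destruct (TJ (-1) Am1) as [U2 V2].
destruct (TJ 3 A3) as [U3 V3]. destruct (TJ (-3) Am3) as [U4 V4].
cbv zeta in *.
assert (0 < K2 * L * E).
{ apply Rmult_lt_0_compat; trivial. apply Rdiv_lt_0_compat; [apply exp_pos|lra]. }
change (x + -1) with (x - 1) in *. change (x + -3) with (x - 3) in *.
lra.
Qed.

(** * Quadratic forms *)

(** Polynomial growth is what makes sums against [Cmod (u m) ^ 2] converge for [u] in every Sobolev
    space. [Series] has no meaningful value otherwise, so each row-by-row comparison rests on it. *)
Definition tame (f : Z -> R) : Prop := exists K p, 0 <= K /\ 0 <= p /\
  forall m, Rabs (f m) <= K * Rpower (jap (IZR m)) p.

Lemma jap_power_ge_1 (p x : R) : 0 <= p -> 1 <= Rpower (jap x) p.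
Proof.
intros Hp. rewrite <- (Rpower_O (jap x)).
- apply Rle_Rpower; [apply jap_pos|trivial].
- assert (P := jap_pos x). lra.
Qed.

Lemma tame_const (c : R) : tame (fun _ => c).
Proof.
exists (Rabs c), 0. split; [apply Rabs_pos|]. split; [lra|]. intros m.
assert (H := jap_power_ge_1 0 (IZR m) (Rle_refl 0)). assert (P := Rabs_pos c). nra.
Qed.

Lemma tame_IZR : tame IZR.
Proof.
exists 1, 1. split; [lra|]. split; [lra|]. intros m.
assert (P := jap_pos (IZR m)). rewrite Rpower_1 by lra. rewrite Rmult_1_l. apply jap_ge.
Qed.

Lemma tame_mult (f g : Z -> R) : tame f -> tame g -> tame (fun m => f m * g m).
Proof.
intros (K & p & HK & Hp & F) (K' & p' & HK' & Hp' & G).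
exists (K * K'), (p + p'). split; [now apply Rmult_le_pos|]. split; [lra|]. intros m.
rewrite Rabs_mult, Rpower_plus.
replace (K * K' * _) with
  (K * Rpower (jap (IZR m)) p * (K' * Rpower (jap (IZR m)) p')) by ring.
apply Rmult_le_compat; trivial; apply Rabs_pos.
Qed.

Lemma tame_plus (f g : Z -> R) : tame f -> tame g -> tame (fun m => f m + g m).
Proof.
intros (K & p & HK & Hp & F) (K' & p' & HK' & Hp' & G).
exists (K + K'), (p + p'). split; [lra|]. split; [lra|]. intros m.
eapply Rle_trans; [apply Rabs_triang|]. specialize (F m). specialize (G m).
rewrite Rpower_plus.
assert (P := jap_power_ge_1 p (IZR m) Hp). assert (P' := jap_power_ge_1 p' (IZR m) Hp').
set (a := Rpower (jap (IZR m)) p) in *. set (b := Rpower (jap (IZR m)) p') in *.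
assert (K * a <= K * (a * b)) by (apply Rmult_le_compat_l; nra).
assert (K' * b <= K' * (a * b)) by (apply Rmult_le_compat_l; nra). lra.
Qed.

Lemma tame_abs (f : Z -> R) : tame f -> tame (fun m => Rabs (f m)).
Proof.
intros (K & p & HK & Hp & F). exists K, p. split; trivial. split; trivial.
intros m. now rewrite Rabs_Rabsolu.
Qed.

Lemma tame_shift (f : Z -> R) (n : Z) : (-3 <= n <= 3)%Z ->
  tame f -> tame (fun m => f (m + n)%Z).
Proof.
intros Hn (K & p & HK & Hp & F). exists (K * Rpower 4 p), p.
split; [apply Rmult_le_pos; [trivial|apply Rlt_le, exp_pos]|]. split; trivial.
intros m. eapply Rle_trans; [apply F|]. rewrite Rmult_assoc.
apply Rmult_le_compat_l; trivial. rewrite plus_IZR. apply jap_power_shift; trivial.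
rewrite <- abs_IZR. apply IZR_le. lia.
Qed.

Lemma tame_weight (s RR : R) : 0 <= s -> 0 < RR -> tame (fun m => weight s RR (IZR m)).
Proof.
intros Hs HR. exists 1, (2 * s). split; [lra|]. split; [lra|]. intros m.
assert (W := weight_bound s RR (IZR m) HR Hs). rewrite Rabs_pos_eq; lra.
Qed.

Lemma tame_cutoff (delta0 : R) (chi : R -> R -> R) (Hchi : BW_cutoff delta0 chi) :
  tame (fun m => chi 2 (IZR m)).
Proof.
destruct (cutoff_near_one _ _ Hchi) as (L & HL & H). exists L, 0.
split; [lra|]. split; [lra|]. intros m. destruct (H (IZR m)) as [B _].
assert (P := jap_power_ge_1 0 (IZR m) (Rle_refl 0)). nra.
Qed.

Lemma ex_Zseries_tame (f : Z -> R) (u : pdist) : tame f -> in_H_infty u ->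
  ex_Zseries (fun m => f m * Cmod (u m) ^ 2).
Proof.
intros (K & p & HK & Hp & F) Hu.
apply ex_Zseries_le with (1 := ex_Zseries_scal K _ (Hu (p / 2))). intros m.
unfold sobolev_term. replace (2 * (p / 2)) with p by field.
rewrite Rabs_mult, (Rabs_pos_eq (_ ^ 2)), <- Rmult_assoc by apply pow2_ge_0.
apply Rmult_le_compat_r; [apply pow2_ge_0|apply F].
Qed.

Lemma quad_le (f g : Z -> R) (u : pdist) : tame f -> tame g -> in_H_infty u ->
  (forall k, f k <= g k) -> quad f u <= quad g u.
Proof.
intros Hf Hg Hu H. apply Zseries_le; try (now apply ex_Zseries_tame).
intros k. apply Rmult_le_compat_r; [apply pow2_ge_0|apply H].
Qed.

Lemma quad_plus (f g : Z -> R) (u : pdist) : tame f -> tame g -> in_H_infty u ->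
  quad (fun k => f k + g k) u = quad f u + quad g u.
Proof.
intros Hf Hg Hu. unfold quad. rewrite <- Zseries_plus; try (now apply ex_Zseries_tame).
apply Zseries_ext; intros k; ring.
Qed.

Lemma diag_tame_form (d : Z -> R) (u : pdist) : tame d -> in_H_infty u ->
  ex_Zseries (fun k => Cmod (diag d u k * Cconj (u k))) /\
  pairing (diag d u) u = RtoC (quad d u).
Proof. intros Hd Hu. apply diag_form, ex_Zseries_tame; trivial. now apply tame_abs. Qed.

(** The Gershgorin radius of row [m] of [hop n b]. *)
Definition row_sum (n : Z) (b : Z -> C) (m : Z) : R :=
  Cmod (b (m - n)%Z) + Cmod (b (m + n)%Z).

Lemma tame_row_sum (n : Z) (b : Z -> C) : (-3 <= n <= 3)%Z ->
  tame (fun m => Cmod (b m)) -> tame (row_sum n b).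
Proof.
intros Hn Hb. apply tame_plus.
- apply (tame_shift (fun m => Cmod (b m)) (- n)); trivial. lia.
- now apply (tame_shift (fun m => Cmod (b m)) n).
Qed.

Lemma hop_tame_form (n : Z) (b : Z -> C) (u : pdist) : (-3 <= n <= 3)%Z ->
  tame (fun m => Cmod (b m)) -> in_H_infty u ->
  ex_Zseries (fun k => Cmod (hop n b u k * Cconj (u k))) /\
  exists S, pairing (hop n b u) u = RtoC S /\ Rabs S <= quad (row_sum n b) u.
Proof.
intros Hn Hb Hu. apply hop_form.
- apply (ex_Zseries_tame (fun m => Cmod (b (m - n)%Z))); trivial.
  apply (tame_shift (fun m => Cmod (b m)) (- n)); trivial. lia.
- apply (ex_Zseries_tame (fun m => Cmod (b (m + n)%Z))); trivial.
  now apply (tame_shift (fun m => Cmod (b m)) n).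
Qed.

(** Both forms are real, which settles the imaginary parts in [Cge]; the hop form is at most its row
    sums, hence at most the diagonal form. *)
Lemma op_ge_diag_hop (e : Z -> R) (b : Z -> C) (A B : operator) :
  tame e -> tame (fun m => Cmod (b m)) ->
  (forall u k, A u k = diag e u k) -> (forall u k, B u k = hop 1 b u k) ->
  (forall k, row_sum 1 b k <= e k) -> op_ge A B.
Proof.
intros He Hb HA HB H u Hu.
rewrite (functional_extensionality _ _ (HA u)), (functional_extensionality _ _ (HB u)).
destruct (diag_tame_form e u He Hu) as [_ ->].
destruct (hop_tame_form 1 b u ltac:(lia) Hb Hu) as (_ & S & -> & HS).
split; [trivial|]. simpl.
assert (Q := quad_le _ _ u (tame_row_sum 1 b ltac:(lia) Hb) He Hu H).
assert (T := Rle_abs S). lra.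
Qed.

Lemma op_ge_pentadiag (d e : Z -> R) (b1 b2 : Z -> C) (A B : operator) :
  tame d -> tame e -> tame (fun m => Cmod (b1 m)) -> tame (fun m => Cmod (b2 m)) ->
  (forall u k, A u k = (diag d u k + (hop 1 b1 u k + hop 2 b2 u k))%C) ->
  (forall u k, B u k = diag e u k) ->
  (forall k, e k + (row_sum 1 b1 k + row_sum 2 b2 k) <= d k) -> op_ge A B.
Proof.
intros Hd He H1 H2 HA HB H u Hu.
rewrite (functional_extensionality _ _ (HA u)), (functional_extensionality _ _ (HB u)).
destruct (diag_tame_form e u He Hu) as [_ ->].
destruct (diag_tame_form d u Hd Hu) as [Xd Fd].
destruct (hop_tame_form 1 b1 u ltac:(lia) H1 Hu) as (X1 & S1 & F1 & B1).
destruct (hop_tame_form 2 b2 u ltac:(lia) H2 Hu) as (X2 & S2 & F2 & B2).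
assert (R1 := tame_row_sum 1 b1 ltac:(lia) H1).
assert (R2 := tame_row_sum 2 b2 ltac:(lia) H2).
rewrite pairing_plus, pairing_plus, Fd, F1, F2; trivial.
- split; [unfold Im; simpl; ring|]. simpl.
  assert (R12 := tame_plus _ _ R1 R2).
  assert (Q := quad_le _ _ u (tame_plus _ _ He R12) Hd Hu H).
  assert (P1 := quad_plus _ _ u He R12 Hu). assert (P2 := quad_plus _ _ u R1 R2 Hu).
  cbv beta in *.
  apply Rabs_le_between in B1. apply Rabs_le_between in B2. lra.
- apply ex_Zseries_le with (1 := ex_Zseries_plus _ _ X1 X2). intros k.
  rewrite Rabs_pos_eq by apply Cmod_ge_0. rewrite Cmult_plus_distr_r. apply Cmod_triangle.
Qed.

(** The remainders of both parts are M <D>^{2s} up to sign, which explains the absolute value on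
    [e]. Termwise, <k>^{-2s} (M <k>^{2s})^2 is M^2 <k>^{2s}. *)
Lemma bounded_linear_diag (s M : R) (e : Z -> R) : 0 <= M ->
  (forall k, Rabs (e k) = M * Rpower (jap (IZR k)) (2 * s)) ->
  bounded_linear s (- s) M (diag e).
Proof.
intros HM He. split.
- intros c u v _ _ k. unfold diag. ring.
- intros u Hu.
  assert (T : forall k, sobolev_term (- s) (diag e u) k = M ^ 2 * sobolev_term s u k).
  { intros k. unfold sobolev_term, diag.
    rewrite Cmod_mult, Cmod_R, He.
    replace (2 * - s) with (- (2 * s)) by ring. rewrite Rpower_Ropp.
    assert (P : 0 < Rpower (jap (IZR k)) (2 * s)) by apply exp_pos.
    field. lra. }
  split.
  + apply ex_Zseries_ext with (fun k => M ^ 2 * sobolev_term s u k); [easy|].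
    now apply ex_Zseries_scal.
  + unfold norm_H. rewrite (Zseries_ext _ _ T), Zseries_scal, sqrt_mult_alt, sqrt_pow2.
    * lra.
    * trivial.
    * apply pow2_ge_0.
Qed.

(** A real symbol has conjugate Fourier coefficients at 2 and -2, and the Weyl midpoint is common to
    both entries; this is exactly the Hermitian shape of [hop]. *)
Lemma OpBW_real (delta0 : R) (chi : R -> R -> R) (Hchi : BW_cutoff delta0 chi)
    (a : symbol) (p0 : R -> R) (p1 : R -> C) :
  (forall x xi, a x xi = RtoC (p0 xi + 2 * Re (p1 xi * expi (2 * x)))) ->
  forall v k, OpBW chi a v k = (diag (fun m => p0 (IZR m)) v k
    + hop 1 (fun m => RtoC (chi 2 (IZR m)) * p1 (IZR m))%C v k)%C.
Proof.
intros Ha v k.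
rewrite (OpBW_trig2 _ _ Hchi a (fun xi => RtoC (p0 xi)) p1 (fun xi => Cconj (p1 xi))).
- unfold diag, hop. rewrite Cmult_conj. change (2 * 1)%Z with 2%Z.
  replace (Cconj (RtoC (chi 2 (IZR (k + 1))))) with (RtoC (chi 2 (IZR (k + 1))))
    by (unfold Cconj, RtoC; simpl; f_equal; ring).
  ring.
- intros x xi. rewrite Ha. unfold trig2. rewrite <- expi_conj.
  destruct (p1 xi) as [a1 a2], (expi (2 * x)) as [e1 e2].
  unfold RtoC, Cplus, Cmult, Cconj, Re; simpl. f_equal; ring.
Qed.

(** * The operators of the commutator estimate *)

Lemma tame_Cmod_scal (z : C) (f : Z -> R) :
  tame f -> tame (fun m => Cmod (z * RtoC (f m))).
Proof.
intros Hf. replace (fun m => Cmod (z * RtoC (f m))) with (fun m => Cmod z * Rabs (f m)).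
- apply (tame_mult (fun _ => Cmod z)); [apply tame_const|now apply tame_abs].
- apply functional_extensionality; intros m. now rewrite Cmod_mult, Cmod_R.
Qed.

(** [- Im z = Re (i z)], so the symbol is twice the real part of [(i zeta / 2) w] times e^{2ix}. *)
Definition opA_coeff (chi : R -> R -> R) (s RR : R) (zeta : C) (m : Z) : C :=
  (Ci * zeta * RtoC (chi 2 (IZR m) * weight s RR (IZR m) / 2))%C.

Definition comm_diag (chi : R -> R -> R) (s RR : R) (zeta : C) (m : Z) : R :=
  Cmod zeta ^ 2 *
  (chi 2 (IZR (m + 1)) ^ 2 * weight s RR (IZR (m + 1)) * IZR (m + 1)
   - chi 2 (IZR (m - 1)) ^ 2 * weight s RR (IZR (m - 1)) * IZR (m - 1)).

(** Commuting with multiplication by [J k] multiplies an entry at distance 2 by 2 up to sign, which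
    absorbs the 1/2 of [opA_coeff]; the two factors i and the sign make 1. *)
Definition comm_hop1 (chi : R -> R -> R) (s RR J : R) (zeta : C) (m : Z) : C :=
  (zeta * RtoC (J * (chi 2 (IZR m) * weight s RR (IZR m))))%C.

Definition comm_hop2 (chi : R -> R -> R) (s RR : R) (zeta : C) (m : Z) : C :=
  (zeta * zeta * RtoC (- / 2 * (chi 2 (IZR (m + 1)) * chi 2 (IZR (m - 1)))
                       * gam s RR (IZR m)))%C.

Section Operators.
Variables (delta0 : R) (chi : R -> R -> R) (Hchi : BW_cutoff delta0 chi).
Variables (s RR : R) (z1 zm1 : C).

Let zeta : C := (z1 * Cconj zm1)%C.

Lemma opA_hop (u : pdist) (k : Z) : opA chi s RR z1 zm1 u k = hop 1 (opA_coeff chi s RR zeta) u k.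
Proof.
unfold opA. rewrite (OpBW_real _ _ Hchi _ (fun _ => 0)
  (fun xi => Ci * zeta * RtoC (weight s RR xi / 2))%C).
- unfold diag. rewrite Cmult_0_l, Cplus_0_l.
  unfold hop, opA_coeff. rewrite !Cmult_conj.
  unfold Rdiv. rewrite !RtoC_mult, !Cmult_conj. ring.
- intros x xi. f_equal. unfold afrak. fold zeta.
  destruct zeta as [a b], (expi (2 * x)) as [e1 e2].
  unfold RtoC, Cplus, Cmult, Ci, Re, Im; simpl. field.
Qed.

Lemma opTransport_hop (u : pdist) (k : Z) : opTransport chi z1 zm1 u k
  = (diag (fun m => J1 z1 zm1 * IZR m)%R u k
     + hop 1 (fun m => zeta * RtoC (chi 2 (IZR m) * IZR m))%C u k)%C.
Proof.
unfold opTransport. rewrite (OpBW_real _ _ Hchi _ (fun xi => J1 z1 zm1 * xi)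
  (fun xi => zeta * RtoC xi)%C).
- f_equal. unfold hop. rewrite !Cmult_conj, !RtoC_mult, !Cmult_conj. ring.
- intros x xi. f_equal. unfold vfrak. fold zeta.
  destruct zeta as [a b], (expi (2 * x)) as [e1 e2].
  unfold RtoC, Cplus, Cmult, Ci, Re, Im; simpl. ring.
Qed.

Lemma opWeight_diag (u : pdist) (k : Z) : opWeight chi s RR u k
  = diag (fun m => weight s RR (IZR m)) u k.
Proof.
unfold opWeight. rewrite (OpBW_real _ _ Hchi _ (weight s RR) (fun _ => RtoC 0)).
- unfold hop. rewrite !Cmult_0_r.
  replace (Cconj (RtoC 0)) with (RtoC 0) by (unfold Cconj, RtoC; simpl; f_equal; ring).
  ring.
- intros x xi. f_equal. rewrite Cmult_0_l. simpl. ring.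
Qed.

(** Two hops in opposite directions return to the diagonal, two in the same direction land at
    distance 4. Once indices are normalized, the values of [w], [chi 2] and [u] become free
    variables and a polynomial identity in real and imaginary parts remains. *)
Lemma commutator_pentadiag (u : pdist) (k : Z) :
  op_scal Ci (op_comm (opA chi s RR z1 zm1) (opTransport chi z1 zm1)) u k
  = (diag (comm_diag chi s RR zeta) u k + (hop 1 (comm_hop1 chi s RR (J1 z1 zm1) zeta) u k
     + hop 2 (comm_hop2 chi s RR zeta) u k))%C.
Proof.
unfold op_scal, op_comm.
rewrite opA_hop, opTransport_hop.
rewrite (functional_extensionality (opTransport chi z1 zm1 u) _ (opTransport_hop u)).
rewrite (functional_extensionality (opA chi s RR z1 zm1 u) _ (opA_hop u)).
unfold comm_diag. rewrite Cmod2_alt.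
unfold diag, hop, opA_coeff, comm_hop1, comm_hop2, gam.
set (g := fun m : Z => chi 2 (IZR m)). set (w := fun m : Z => weight s RR (IZR m)).
change (2 * 1)%Z with 2%Z. change (2 * 2)%Z with 4%Z.
replace (k - 2 + 2)%Z with k by ring. replace (k + 2 - 2)%Z with k by ring.
replace (k - 2 - 2)%Z with (k - 4)%Z by ring. replace (k + 2 + 2)%Z with (k + 4)%Z by ring.
replace (k - 2 + 1)%Z with (k - 1)%Z by ring. replace (k + 2 - 1)%Z with (k + 1)%Z by ring.
replace (k - 1 - 2)%Z with (k - 3)%Z by ring. replace (k + 1 + 2)%Z with (k + 3)%Z by ring.
replace (k - 2 - 1)%Z with (k - 3)%Z by ring. replace (k + 2 + 1)%Z with (k + 3)%Z by ring.
replace (k - 1 + 2)%Z with (k + 1)%Z by ring. replace (k + 1 - 2)%Z with (k - 1)%Z by ring.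
replace (IZR (k - 2) + 1) with (IZR (k - 1)) by (rewrite !minus_IZR; ring).
replace (IZR (k - 2) - 1) with (IZR (k - 3)) by (rewrite !minus_IZR; ring).
replace (IZR (k + 2) + 1) with (IZR (k + 3)) by (rewrite !plus_IZR; ring).
replace (IZR (k + 2) - 1) with (IZR (k + 1)) by (rewrite !plus_IZR; ring).
fold (w (k - 1)%Z) (w (k - 3)%Z) (w (k + 1)%Z) (w (k + 3)%Z).
generalize (w (k - 1)%Z) (w (k - 3)%Z) (w (k + 1)%Z) (w (k + 3)%Z). intros wm1 wm3 wp1 wp3.
fold (g (k - 1)%Z) (g (k - 3)%Z) (g (k + 1)%Z) (g (k + 3)%Z).
generalize (g (k - 1)%Z) (g (k - 3)%Z) (g (k + 1)%Z) (g (k + 3)%Z). intros gm1 gm3 gp1 gp3.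
rewrite !minus_IZR, !plus_IZR.
generalize (IZR k) (J1 z1 zm1). intros x j.
destruct (u k) as [u0 v0], (u (k - 2)%Z) as [um2 vm2], (u (k + 2)%Z) as [up2 vp2],
  (u (k - 4)%Z) as [um4 vm4], (u (k + 4)%Z) as [up4 vp4].
destruct zeta as [a b].
unfold RtoC, Cminus, Copp, Cplus, Cmult, Cconj, Ci, Re, Im; simpl.
f_equal; field.
Qed.

End Operators.

(** * Row sums and polynomial growth of the coefficients *)

Lemma comm_hop1_row_sum (chi : R -> R -> R) (s RR : R) (J : R) (zeta : C) (k : Z) :
  0 <= s -> 1 < RR -> 0 <= J ->
  row_sum 1 (comm_hop1 chi s RR J zeta) k = Cmod zeta * J *
    (Rabs (chi 2 (IZR k - 1)) * weight s RR (IZR k - 1)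
     + Rabs (chi 2 (IZR k + 1)) * weight s RR (IZR k + 1)).
Proof.
intros Hs HR HJ. unfold row_sum, comm_hop1. rewrite minus_IZR, plus_IZR.
rewrite !(Cmod_mult _ (RtoC _)), !Cmod_R, !Rabs_mult, (Rabs_pos_eq J) by trivial.
rewrite 2!(Rabs_pos_eq (weight _ _ _)) by (apply weight_bound; lra). ring.
Qed.

Lemma opA_row_sum (chi : R -> R -> R) (s RR : R) (zeta : C) (k : Z) :
  0 <= s -> 1 < RR ->
  row_sum 1 (opA_coeff chi s RR zeta) k = Cmod zeta / 2 *
    (Rabs (chi 2 (IZR k - 1)) * weight s RR (IZR k - 1)
     + Rabs (chi 2 (IZR k + 1)) * weight s RR (IZR k + 1)).
Proof.
intros Hs HR. unfold row_sum, opA_coeff, Rdiv. rewrite minus_IZR, plus_IZR.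
assert (HC : Cmod Ci = 1).
{ replace Ci with (expi (PI / 2)) by (unfold expi; now rewrite cos_PI2, sin_PI2).
  apply Cmod_expi. }
rewrite !(Cmod_mult _ (RtoC _)), (Cmod_mult Ci), HC, !Cmod_R, !Rabs_mult.
rewrite (Rabs_pos_eq (/ 2)) by lra.
rewrite 2!(Rabs_pos_eq (weight _ _ _)) by (apply weight_bound; lra). ring.
Qed.

(** [gam_nonneg] removes the absolute value, so the radius stays linear in the weight and can cancel
    against the diagonal. *)
Lemma comm_hop2_row_sum (chi : R -> R -> R) (s RR : R) (zeta : C) (k : Z) :
  1 <= 2 * s -> 1 < RR -> let x := IZR k in
  row_sum 2 (comm_hop2 chi s RR zeta) k = Cmod zeta ^ 2 *
    (/ 2 * (Rabs (chi 2 (x + 3) * chi 2 (x + 1)) * gam s RR (x + 2))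
     + / 2 * (Rabs (chi 2 (x - 1) * chi 2 (x - 3)) * gam s RR (x - 2))).
Proof.
intros Hs HR x. unfold row_sum, comm_hop2.
assert (G1 := gam_nonneg s RR (k - 2) Hs HR).
assert (G2 := gam_nonneg s RR (k + 2) Hs HR).
rewrite !(Cmod_mult _ (RtoC _)), !Cmod_R, !(Rabs_mult _ (gam _ _ _)).
rewrite !(Rabs_pos_eq (gam _ _ _)) by trivial.
rewrite !(Rabs_mult (- / 2)), Rabs_Ropp, (Rabs_pos_eq (/ 2)) by lra.
replace (k - 2 + 1)%Z with (k - 1)%Z by ring. replace (k - 2 - 1)%Z with (k - 3)%Z by ring.
replace (k + 2 + 1)%Z with (k + 3)%Z by ring. replace (k + 2 - 1)%Z with (k + 1)%Z by ring.
rewrite !minus_IZR, !plus_IZR. fold x. rewrite (Cmod_mult zeta zeta). ring.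
Qed.

Lemma tame_gam (s RR : R) : 0 <= s -> 0 < RR -> tame (fun m => gam s RR (IZR m)).
Proof.
intros Hs HR. assert (W := tame_weight s RR Hs HR).
replace (fun m => gam s RR (IZR m)) with (fun m : Z =>
  weight s RR (IZR (m + 1)) * (IZR m + -1)
  + (-1) * ((IZR m + 1) * weight s RR (IZR (m + -1)))).
- apply tame_plus; [|apply (tame_mult (fun _ => -1)); [apply tame_const|]].
  + apply (tame_mult (fun m => weight s RR (IZR (m + 1)))).
    * apply (tame_shift _ 1 ltac:(lia) W).
    * apply tame_plus; [apply tame_IZR|apply tame_const].
  + apply (tame_mult (fun m => IZR m + 1)).
    * apply tame_plus; [apply tame_IZR|apply tame_const].
    * apply (tame_shift _ (-1) ltac:(lia) W).
- apply functional_extensionality; intros m. unfold gam.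
  change (m + -1)%Z with (m - 1)%Z. rewrite plus_IZR, minus_IZR. ring.
Qed.

Section Tame.
Variables (delta0 : R) (chi : R -> R -> R) (Hchi : BW_cutoff delta0 chi).
Variables (s RR : R) (Hs : 0 <= s) (HR : 0 < RR) (zeta : C).

Let C0 := tame_cutoff _ _ Hchi.
Let W0 := tame_weight s RR Hs HR.

Lemma tame_opA_coeff : tame (fun m => Cmod (opA_coeff chi s RR zeta m)).
Proof.
apply tame_Cmod_scal.
apply (tame_mult _ (fun _ => / 2)); [now apply tame_mult|apply tame_const].
Qed.

Lemma tame_comm_hop1 (J : R) : tame (fun m => Cmod (comm_hop1 chi s RR J zeta m)).
Proof.
apply tame_Cmod_scal.
apply (tame_mult (fun _ => J)); [apply tame_const|now apply tame_mult].
Qed.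

Lemma tame_comm_hop2 : tame (fun m => Cmod (comm_hop2 chi s RR zeta m)).
Proof.
apply tame_Cmod_scal.
apply (tame_mult (fun m => - / 2 * _)); [|now apply tame_gam].
apply (tame_mult (fun _ => - / 2)); [apply tame_const|].
apply tame_mult.
- apply (tame_shift _ 1 ltac:(lia) C0).
- apply (tame_shift _ (-1) ltac:(lia) C0).
Qed.

Lemma tame_comm_diag : tame (comm_diag chi s RR zeta).
Proof.
assert (T : tame (fun m => chi 2 (IZR m) ^ 2 * weight s RR (IZR m) * IZR m)).
{ apply tame_mult; [|apply tame_IZR]. apply tame_mult; [|trivial].
  apply tame_mult; [trivial|]. apply tame_mult; [trivial|apply tame_const]. }
apply (tame_mult (fun _ => _)); [apply tame_const|].
replace (fun m : Z => _) with (fun m : Z =>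
  chi 2 (IZR (m + 1)) ^ 2 * weight s RR (IZR (m + 1)) * IZR (m + 1)
  + (-1) * (chi 2 (IZR (m + -1)) ^ 2 * weight s RR (IZR (m + -1)) * IZR (m + -1))).
- apply tame_plus; [apply (tame_shift _ 1 ltac:(lia) T)|].
  apply (tame_mult (fun _ => -1)); [apply tame_const|].
  apply (tame_shift _ (-1) ltac:(lia) T).
- apply functional_extensionality; intros m.
  change (m + -1)%Z with (m - 1)%Z. ring.
Qed.

End Tame.

Lemma tame_jap_power (p : R) : 0 <= p -> tame (fun m => Rpower (jap (IZR m)) p).
Proof.
intros Hp. exists 1, p. split; [lra|]. split; trivial. intros m.
rewrite Rabs_pos_eq; [lra|apply Rlt_le, exp_pos].
Qed.

Theorem lemma6p2 (delta0 : R) (chi : R -> R -> R) (Hchi : BW_cutoff delta0 chi)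
    (s : R) (Hs : 1 < s) :
  exists Cs : R, 0 < Cs /\
  forall (RR : R), 1 < RR -> forall (z1 zm1 : C),
    (exists Rem : operator,
       bounded_linear s (- s) (Cs * ((Cmod z1 ^ 4 + Cmod zm1 ^ 4) / RR)) Rem /\
       op_ge (op_scal Ci (op_comm (opA chi s RR z1 zm1) (opTransport chi z1 zm1)))
             (op_add (op_scal (RtoC (I1 z1 zm1)) (opWeight chi s RR)) Rem)) /\
    (exists Rem : operator,
       bounded_linear s (- s) (Cs * ((Cmod z1 ^ 2 + Cmod zm1 ^ 2) / RR ^ 2)) Rem /\
       op_ge (op_add (op_scal (RtoC (2 * Cmod z1 * Cmod zm1)) (opWeight chi s RR)) Rem)
             (opA chi s RR z1 zm1)).
Proof.
destruct (hop1_row_bound _ _ Hchi s ltac:(lra)) as (K1 & HK1 & B1).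
destruct (commutator_row_bound _ _ Hchi s ltac:(lra)) as (K2 & HK2 & B2).
(* [K1] pays for the entries at distance 2, [K2] for the diagonal and the entries at distance 4. *)
exists (K1 + K2). split; [lra|]. intros RR HR z1 zm1.
assert (Hs0 : 0 <= s) by lra. assert (HR0 : 0 < RR) by lra.
set (zeta := (z1 * Cconj zm1)%C).
assert (HZ : Cmod zeta = Cmod z1 * Cmod zm1) by (unfold zeta; now rewrite Cmod_mult, Cmod_conj).
assert (HJ : 0 <= J1 z1 zm1).
{ unfold J1. generalize (pow2_ge_0 (Cmod z1)) (pow2_ge_0 (Cmod zm1)). lra. }
assert (Ha := Cmod_ge_0 z1). assert (Hb := Cmod_ge_0 zm1).
assert (W0 := tame_weight s RR Hs0 HR0).
assert (X0 := tame_jap_power (2 * s) ltac:(lra)).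
assert (HX : forall k, 0 < Rpower (jap (IZR k)) (2 * s)) by (intros; apply exp_pos).
assert (HX1 : forall k, 0 < Rpower (jap (IZR k)) (2 * s) / RR)
  by (intros; apply Rdiv_lt_0_compat; trivial).
assert (HX2 : forall k, 0 < Rpower (jap (IZR k)) (2 * s) / RR ^ 2)
  by (intros; apply Rdiv_lt_0_compat; trivial; now apply pow_lt).
split.
- set (M := (K1 + K2) * ((Cmod z1 ^ 4 + Cmod zm1 ^ 4) / RR)).
  assert (N4 : 0 <= Cmod z1 ^ 4 + Cmod zm1 ^ 4)
    by (apply Rplus_le_le_0_compat; now apply pow_le).
  assert (HM : 0 <= M).
  { apply Rmult_le_pos; [lra|]. apply Rmult_le_pos; trivial.
    now apply Rlt_le, Rinv_0_lt_compat. }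
  (* The remainder sits on the smaller side, hence the minus sign. *)
  exists (diag (fun k => - M * Rpower (jap (IZR k)) (2 * s))). split.
  + apply bounded_linear_diag; trivial. intros k.
    rewrite Rabs_mult, Rabs_Ropp, !Rabs_pos_eq; trivial. now apply Rlt_le.
  + apply (op_ge_pentadiag (comm_diag chi s RR zeta)
      (fun k => I1 z1 zm1 * weight s RR (IZR k) + - M * Rpower (jap (IZR k)) (2 * s))
      (comm_hop1 chi s RR (J1 z1 zm1) zeta) (comm_hop2 chi s RR zeta)).
    * now apply tame_comm_diag with delta0.
    * apply tame_plus; apply (tame_mult (fun _ => _)); trivial; apply tame_const.
    * now apply tame_comm_hop1 with delta0.
    * now apply tame_comm_hop2 with delta0.
    * now apply commutator_pentadiag with delta0.
    * intros u k. unfold op_add, op_scal. rewrite (opWeight_diag _ _ Hchi).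
      unfold diag. rewrite RtoC_plus, !RtoC_mult. ring.
    * intros k. rewrite comm_hop1_row_sum, comm_hop2_row_sum, HZ by (trivial; lra).
      unfold comm_diag. rewrite HZ, plus_IZR, minus_IZR.
      specialize (B1 RR (IZR k) HR). specialize (B2 RR k HR). cbv zeta in B2.
      replace (- M * Rpower (jap (IZR k)) (2 * s))
        with (- ((K1 + K2) * (Cmod z1 ^ 4 + Cmod zm1 ^ 4) * (Rpower (jap (IZR k)) (2 * s) / RR)))
        by (unfold M; field; lra).
      specialize (HX1 k). specialize (HX2 k).
      (* Since [RR > 1], the error of the entries at distance 2 can be charged at the weaker rate 1
         / RR. *)
      assert (E12 : Rpower (jap (IZR k)) (2 * s) / RR ^ 2 <= Rpower (jap (IZR k)) (2 * s) / RR).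
      { apply Rmult_le_compat_l; [now apply Rlt_le|]. apply Rinv_le_contravar; nra. }
      set (X1 := Rpower (jap (IZR k)) (2 * s) / RR) in *.
      set (X2 := Rpower (jap (IZR k)) (2 * s) / RR ^ 2) in *.
      unfold I1, J1.
      set (a := Cmod z1) in *. set (b := Cmod zm1) in *.
      match type of B1 with ?l <= _ => set (h1 := l) in * end.
      match type of B2 with _ <= ?d - ?p - ?q + _ =>
        set (D := d) in *; set (h2 := p) in *; set (h3 := q) in * end.
      set (w := weight s RR (IZR k)) in *.
      assert (Z0 : 0 <= a * b) by now apply Rmult_le_pos.
      assert (J0 : 0 <= a * b * ((a ^ 2 + b ^ 2) / 2))
        by (apply Rmult_le_pos; [exact Z0|exact HJ]).
      assert (Q := pow2_ge_0 (a ^ 2 - b ^ 2)). assert (Q' := pow2_ge_0 (a - b)).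
      (* The amplitudes in front of the two errors, |zeta|^2 and |zeta| J1, are both of degree four
         in (a, b). *)
      assert (Z4 : (a * b) ^ 2 <= a ^ 4 + b ^ 4).
      { assert (0 <= (a * b) ^ 2) by apply pow2_ge_0. nra. }
      assert (J4 : a * b * ((a ^ 2 + b ^ 2) / 2) <= a ^ 4 + b ^ 4) by nra.
      assert (P1 : a * b * ((a ^ 2 + b ^ 2) / 2) * h1
        <= a * b * ((a ^ 2 + b ^ 2) / 2) * (2 * w) + (a ^ 4 + b ^ 4) * (K1 * X1)).
      { apply Rle_trans with (a * b * ((a ^ 2 + b ^ 2) / 2) * (2 * w + K1 * X1)).
        - apply Rmult_le_compat_l; trivial.
          assert (K1 * X2 <= K1 * X1) by (apply Rmult_le_compat_l; lra). lra.
        - rewrite Rmult_plus_distr_l. apply Rplus_le_compat_l, Rmult_le_compat_r; trivial.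
          apply Rmult_le_pos; lra. }
      assert (P2 : (a * b) ^ 2 * (4 * w + h2 + h3)
        <= (a * b) ^ 2 * D + (a ^ 4 + b ^ 4) * (K2 * X1)).
      { apply Rle_trans with ((a * b) ^ 2 * (D + K2 * X1)).
        - apply Rmult_le_compat_l; [apply pow2_ge_0|lra].
        - rewrite Rmult_plus_distr_l. apply Rplus_le_compat_l, Rmult_le_compat_r; trivial.
          apply Rmult_le_pos; lra. }
      (* In the sum of [P1] and [P2] the main terms combine to [4 (a b)^2 w - 2 a b J1 w], which is
         [I1 w]. *)
      lra.
- set (M := (K1 + K2) * ((Cmod z1 ^ 2 + Cmod zm1 ^ 2) / RR ^ 2)).
  assert (N2 : 0 <= Cmod z1 ^ 2 + Cmod zm1 ^ 2)
    by (apply Rplus_le_le_0_compat; now apply pow_le).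
  assert (HM : 0 <= M).
  { apply Rmult_le_pos; [lra|]. apply Rmult_le_pos; trivial.
    now apply Rlt_le, Rinv_0_lt_compat, pow_lt. }
  (* Here the remainder is added to the larger side, hence the plus sign. *)
  exists (diag (fun k => M * Rpower (jap (IZR k)) (2 * s))). split.
  + apply bounded_linear_diag; trivial. intros k.
    rewrite Rabs_mult, !Rabs_pos_eq; trivial. now apply Rlt_le.
  + apply (op_ge_diag_hop
      (fun k => 2 * Cmod z1 * Cmod zm1 * weight s RR (IZR k) + M * Rpower (jap (IZR k)) (2 * s))
      (opA_coeff chi s RR zeta)).
    * apply tame_plus; apply (tame_mult (fun _ => _)); trivial; apply tame_const.
    * now apply tame_opA_coeff with delta0.
    * intros u k. unfold op_add, op_scal. rewrite (opWeight_diag _ _ Hchi).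
      unfold diag. rewrite RtoC_plus, !RtoC_mult. ring.
    * now apply opA_hop with delta0.
    * intros k. rewrite opA_row_sum, HZ by lra.
      specialize (B1 RR (IZR k) HR). specialize (HX2 k).
      replace (M * Rpower (jap (IZR k)) (2 * s))
        with ((K1 + K2) * (Cmod z1 ^ 2 + Cmod zm1 ^ 2) * (Rpower (jap (IZR k)) (2 * s) / RR ^ 2))
        by (unfold M; field; lra).
      set (X2 := Rpower (jap (IZR k)) (2 * s) / RR ^ 2) in *.
      set (a := Cmod z1) in *. set (b := Cmod zm1) in *.
      match type of B1 with ?l <= _ => set (h1 := l) in * end.
      assert (Hw := weight_bound s RR (IZR k) HR0 Hs0).
      set (w := weight s RR (IZR k)) in *.
      assert (Z0 : 0 <= a * b) by now apply Rmult_le_pos.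
      assert (Q := pow2_ge_0 (a - b)).
      assert (Z2 : a * b / 2 <= a ^ 2 + b ^ 2) by nra.
      assert (P1 : a * b / 2 * h1 <= a * b / 2 * (2 * w) + (a ^ 2 + b ^ 2) * (K1 * X2)).
      { apply Rle_trans with (a * b / 2 * (2 * w + K1 * X2)).
        - apply Rmult_le_compat_l; trivial. lra.
        - rewrite Rmult_plus_distr_l. apply Rplus_le_compat_l, Rmult_le_compat_r; trivial.
          apply Rmult_le_pos; lra. }
      assert (0 <= (a ^ 2 + b ^ 2) * (K2 * X2))
        by (apply Rmult_le_pos; trivial; apply Rmult_le_pos; lra).
      (* The row sum is bounded by [a b w] plus errors; this is the gap to [2 a b w]. *)
      assert (0 <= a * b * w) by (apply Rmult_le_pos; lra).
      lra.
Qed.
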